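(* Let $\mathbb{K}$ be $\mathbb{R}$ or $\mathbb{C}$, let $S\subset\mathbb{K}^n$ be a set consisting of $r$ distinct points, and let $f:(\mathbb{K}^n,S)\rightarrow(\mathbb{K}^p,0)$ be a finitely $\mathcal{L}$-determined multigerm. Then $T\mathcal{R}_e(f)\cap T\mathcal{L}_e(f)$ is finitely generated as a $C_{p,0}$-module via $f$.
   Context: All mappings are smooth, meaning of class $C^\infty$ if $\mathbb{K}=\mathbb{R}$ and holomorphic if $\mathbb{K}=\mathbb{C}$. A multigerm is a map-germ $f:(\mathbb{K}^n,S)\rightarrow(\mathbb{K}^p,0)$ where $S$ is a set of $r$ distinct points of $\mathbb{K}^n$ (so every point of $S$ is sent to $0$); it can be identified with the collection of its branches $\{f_k:(\mathbb{K}^n,0)\rightarrow(\mathbb{K}^p,0)\mid 1\le k\le r\}$. $C_{n,S}$ (resp. $C_{p,0}$) is the $\mathbb{K}$-algebra of function-germs $(\mathbb{K}^n,S)\rightarrow\mathbb{K}$ (resp. $(\mathbb{K}^p,0)\rightarrow\mathbb{K}$). For a non-negative integer $i$, $m_{n,S}^i\subset C_{n,S}$ is the set of function-germs $(\mathbb{K}^n,S)\rightarrow\mathbb{K}$ whose Taylor series (at each point of $S$) has zero terms up to degree $i-1$. $\theta_{n,S}(f)$ is the $C_{n,S}$-module of germs (at $S$) of vector fields along $f$, identified with the direct sum of $p$ copies of $C_{n,S}$. $\theta_S(n)=\theta_{n,S}(\mathrm{id}_{(\mathbb{K}^n,S)})$ and $\theta_0(p)=\theta_{p,\{0\}}(\mathrm{id}_{(\mathbb{K}^p,0)})$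 are the modules of germs of vector fields on $(\mathbb{K}^n,S)$ and $(\mathbb{K}^p,0)$. Define $tf:\theta_S(n)\rightarrow\theta_{n,S}(f)$ by $tf(\xi)=df\circ\xi$, where $df$ is the differential of $f$, and $\omega f:\theta_0(p)\rightarrow\theta_{n,S}(f)$ by $\omega f(\eta)=\eta\circ f$. Set $T\mathcal{R}_e(f)=tf(\theta_S(n))$ and $T\mathcal{L}_e(f)=\omega f(\theta_0(p))$. The $C_{p,0}$-module structure ''via $f$'' on $\theta_{n,S}(f)$ and its submodules is $\psi\cdot\zeta=(\psi\circ f)\,\zeta$ for $\psi\in C_{p,0}$. The multigerm $f$ is said to be finitely $\mathcal{L}$-determined if there exists a positive integer $\ell$ such that $m_{n,S}^\ell\theta_{n,S}(f)\subset T\mathcal{L}_e(f)$. *)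

(* Defs.v *)
From HB Require Import structures.
From mathcomp Require Import all_boot all_order all_algebra.
From mathcomp Require Import complex.
From mathcomp Require Import all_classical all_reals all_analysis.

Set Implicit Arguments.
Unset Strict Implicit.
Unset Printing Implicit Defensive.

Import Order.TTheory GRing.Theory Num.Theory.
Import numFieldNormedType.Exports.

Local Open Scope classical_set_scope.
Local Open Scope ring_scope.

Inductive scalars := Reals | Complexes.

Definition scalar_field (R : realType) (b : scalars) : numFieldType :=
  match b with Reals => R | Complexes => R[i] end.

Section Smooth.
Context {K : numFieldType} {V W : normedModType K}.

(* For finite-dimensional V. *)
Fixpoint Ck (k : nat) (U : set V) (f : V -> W) : Prop :=
  match k with
  | 0 => forall x, U x -> {for x, continuous f}
  | j.+1 => (forall x, U x -> differentiable f x) /\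
            (forall v, Ck j U ('D_v f))
  end.

Definition Cinfty (U : set V) (f : V -> W) := forall k, Ck k U f.

(* Only used for K the complex numbers. *)
Definition holomorphic (U : set V) (f : V -> W) :=
  forall x, U x -> differentiable f x.

Definition smooth_on (b : scalars) :=
  match b with Reals => Cinfty | Complexes => holomorphic end.

(* A germ at S is represented by a total function, two representatives being
   identified by germ_eq: only the values near S matter. *)
Definition smooth_germ (b : scalars) (S : set V) (f : V -> W) :=
  exists U : set V, [/\ open U, S `<=` U & smooth_on b U f].

Definition germ_eq (S : set V) (f g : V -> W) :=
  forall a, S a -> \forall x \near a, f x = g x.

(* The degree k term, as a function of v = x - a, of the Taylor series at a. *)
Definition taylor_term (k : nat) (f : V -> W) (a v : V) : W :=
  (k`!)%:R^-1 *: iter k (fun g => 'D_v g) f a.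

End Smooth.

(* Sets of germs are given as sets of representatives closed under germ_eq. *)
Section Multigerms.
Context {R : realType} {b : scalars}.
Local Notation K := (scalar_field R b).

Definition multigerm n p (S : set 'rV[K]_n) (f : 'rV[K]_n -> 'rV[K]_p) :=
  smooth_germ b S f /\ (forall a, S a -> f a = 0).

Definition function_germs n (S : set 'rV[K]_n) : set ('rV[K]_n -> K) :=
  [set g | smooth_germ b S g].

Definition mpow n (S : set 'rV[K]_n) (i : nat) : set ('rV[K]_n -> K) :=
  [set g | function_germs S g /\
     forall a, S a -> forall k, (k < i)%N -> forall v, taylor_term k g a v = 0].

(* A vector field along f is given by its p components, so that f only
   determines the target dimension. *)
Definition theta n p (S : set 'rV[K]_n) (f : 'rV[K]_n -> 'rV[K]_p) :
    set ('rV[K]_n -> 'rV[K]_p) :=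
  [set zeta | smooth_germ b S zeta].

Definition theta_id n (S : set 'rV[K]_n) := theta S (@id 'rV[K]_n).

Definition tf n p (f : 'rV[K]_n -> 'rV[K]_p) (xi : 'rV[K]_n -> 'rV[K]_n) :
    'rV[K]_n -> 'rV[K]_p :=
  fun x => 'd f x (xi x).

Definition wf n p (f : 'rV[K]_n -> 'rV[K]_p) (eta : 'rV[K]_p -> 'rV[K]_p) :
    'rV[K]_n -> 'rV[K]_p :=
  eta \o f.

Definition TRe n p (S : set 'rV[K]_n) (f : 'rV[K]_n -> 'rV[K]_p) :
    set ('rV[K]_n -> 'rV[K]_p) :=
  [set zeta | exists2 xi, theta_id S xi & germ_eq S zeta (tf f xi)].

Definition TLe n p (S : set 'rV[K]_n) (f : 'rV[K]_n -> 'rV[K]_p) :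
    set ('rV[K]_n -> 'rV[K]_p) :=
  [set zeta | exists2 eta, theta_id [set 0] eta & germ_eq S zeta (wf f eta)].

(* The product I . M of an ideal I of function germs and a module M. *)
Definition ideal_mul n p (S : set 'rV[K]_n) (I : set ('rV[K]_n -> K))
    (M : set ('rV[K]_n -> 'rV[K]_p)) : set ('rV[K]_n -> 'rV[K]_p) :=
  [set zeta | exists (k : nat) (g : 'I_k -> 'rV[K]_n -> K)
                     (e : 'I_k -> 'rV[K]_n -> 'rV[K]_p),
     [/\ forall j, I (g j), forall j, M (e j)
       & germ_eq S zeta (fun x => \sum_(j < k) g j x *: e j x)]].

Definition finitely_L_determined n p (S : set 'rV[K]_n)
    (f : 'rV[K]_n -> 'rV[K]_p) :=
  exists2 l : nat, (0 < l)%N & ideal_mul S (mpow S l) (theta S f) `<=` TLe S f.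

Definition via n p (f : 'rV[K]_n -> 'rV[K]_p) (psi : 'rV[K]_p -> K)
    (zeta : 'rV[K]_n -> 'rV[K]_p) : 'rV[K]_n -> 'rV[K]_p :=
  fun x => psi (f x) *: zeta x.

Definition span_via n p (S : set 'rV[K]_n) (f : 'rV[K]_n -> 'rV[K]_p) (k : nat)
    (e : 'I_k -> 'rV[K]_n -> 'rV[K]_p) : set ('rV[K]_n -> 'rV[K]_p) :=
  [set zeta | exists2 psi : 'I_k -> 'rV[K]_p -> K,
     forall j, function_germs [set 0] (psi j)
     & germ_eq S zeta (fun x => \sum_(j < k) via f (psi j) (e j) x)].

(* M is a C_{p,0}-submodule via f generated by finitely many elements; each
   generator lies in M since it lies in its own span. *)
Definition finitely_generated_via n p (S : set 'rV[K]_n)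
    (f : 'rV[K]_n -> 'rV[K]_p) (M : set ('rV[K]_n -> 'rV[K]_p)) :=
  exists (k : nat) (e : 'I_k -> 'rV[K]_n -> 'rV[K]_p), M = span_via S f e.

End Multigerms.

(* Main.v *)
Require Import Defs.
From HB Require Import structures.
From mathcomp Require Import all_boot all_order all_algebra.
From mathcomp Require Import complex ring lra.
From mathcomp Require Import all_classical all_reals all_analysis.

(** The main point is that finite determinacy makes Malgrange's preparation
    theorem unnecessary. Applied to the fields (g, 0, ..., 0) it says that
    every g in m_S^l is a pull-back psi o f (for p > 0). As C_{n,S} / m_S^l is
    finite-dimensional, C_{n,S} is generated over C_{p,0} via f by 1 and
    finitely many germs e_t. Let q_s be finitely many generators of an ideal of
    finite codimension inside m_S^l. Then the q_s e_t df/dx_m and q_s df/dx_m lie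
    in TR_e(f) and TL_e(f), and they generate a submodule modulo which every
    element of the intersection is a K-linear combination of the e_t df/dx_m;
    the combinations that lie in TL_e(f) form a finite-dimensional space.

    The ideal comes from Hadamard's lemma
      g(x) = g(a) + sum_j (x_j - a_j) int_0^1 (d_j g)(a + s (x - a)) ds,
    which works alike over R and C once derivatives of holomorphic maps are
    known to be holomorphic. For maps assumed only to be differentiable this
    uses Goursat's lemma, in the form that the mean of Re H over a circle does
    not depend on the radius; hence Re H + eps |z|^2 has no interior maximum,
    which gives the maximum principle, uniform second-order Taylor bounds, and
    so the differentiability of limits of difference quotients. *)

Set Implicit Arguments.
Unset Strict Implicit.
Unset Printing Implicit Defensive.

Import Order.TTheory GRing.Theory Num.Theory.
Import numFieldNormedType.Exports.

Local Open Scope classical_set_scope.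
Local Open Scope ring_scope.

(** * Differentiation *)

(** Finite generation of TR_e(f) alone would not suffice: over R, for p > 0, the ring C_{p,0} is not
    Noetherian, so submodules of finitely generated modules need not be finitely generated. The
    intersection is saved by being squeezed: N = sum of q_s C_{n,S} df/dx_m lies in m_S^l theta(f),
    hence in TL_e(f), and TR_e(f) / N has finite dimension over K. Any C_{p,0}-module between N and
    TR_e(f) is therefore generated by generators of N and finitely many further elements.

    The analytic half is there because over C smoothness means only differentiability at each point,
    while Hadamard's lemma has to differentiate the partial derivatives again. Cauchy's integral
    formula is replaced by division: F - F(0) is divided by z, and the quotient once more by a
    linear factor. On the boundary of a square this costs a constant, and the maximum principle
    carries the bound inside. The quotients are undefined at one or two points, so the maximum
    principle must tolerate exceptional points. *)

Section DifferentialEps.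
Context {K : numFieldType} {V W : normedModType K}.
Implicit Types (f : V -> W) (x : V).

Lemma differentiable_near f x : differentiable f x ->
  forall e, 0 < e -> \forall h \near 0, `|f (x + h) - f x - 'd f x h| <= e * `|h|.
Proof.
move=> /diff_locally /eqaddoP H e e0.
by have := H e e0; apply: filterS => h /=; rewrite /cst /= opprD addrA [x + h]addrC.
Qed.

Lemma near_differentiable f x (L : {linear V -> W}) : continuous L ->
  (forall e, 0 < e -> \forall h \near 0, `|f (x + h) - f x - L h| <= e * `|h|) ->
  is_diff x f L.
Proof.
move=> cL H.
have E : f \o shift x = cst (f x) + L +o_ 0 id.
  apply/eqaddoP => e e0; have := H e e0; apply: filterS => h /=.
  by rewrite !fctE /= opprD addrA [h + x]addrC.
have D := diff_unique cL E; apply: DiffDef => //.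
by apply/diff_locallyP; rewrite D.
Qed.
End DifferentialEps.

Lemma diff_scale1 (K : numFieldType) (W : normedModType K) (f : K -> W) x h :
  'd f x h = h *: 'd f x 1.
Proof. by rewrite -linearZ /= [_ *: _]mulr1. Qed.

Lemma diff_sub (K : numFieldType) (V : normedModType K) (f g : V -> K) x w :
  differentiable f x -> differentiable g x ->
  differentiable (fun y => f y - g y) x /\
  'd (fun y => f y - g y) x w = 'd f x w - 'd g x w.
Proof.
move=> df dg; split; first exact: (differentiableB df dg).
exact: (congr1 (fun F => F w) (diffB df dg)).
Qed.

Section Rows.
Context {K : numFieldType} {V : normedModType K} {p : nat}.
Implicit Types (f : V -> 'rV[K]_p).

Let coordf f (j : 'I_p) := fun x => f x 0 j : K.

Lemma differentiable_rowP f x :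
  differentiable f x <-> forall j, differentiable (fun y => f y 0 j : K) x.
Proof.
split=> [df j|df].
  by apply: (@differentiable_comp _ _ _ _ f (fun M : 'rV[K]_p => M 0 j : K)) => //;
     exact: differentiable_coord.
have -> : f = (\sum_(j < p) (fun x => coordf f j x *: delta_mx 0 j)).
  by apply/funext => y; rewrite fct_sumE [LHS]row_sum_delta.
by apply: differentiable_sum => j; apply: differentiableZl; exact: df.
Qed.

Lemma derive_row f x v j : differentiable f x ->
  'D_v f x 0 j = 'D_v (fun y => f y 0 j : K) x.
Proof.
move=> df; have dj := (differentiable_rowP f x).1 df.
pose L := fun M : 'rV[K]_p => M 0 j : K.
have Llin : linear L by move=> c A B; rewrite /L !mxE.
pose Lm := GRing.isLinear.Build K 'rV[K]_p K *:%R L Llin.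
pose LL : {linear 'rV[K]_p -> K} := HB.pack L Lm.
have cL : continuous LL by exact: coord_continuous.
rewrite !deriveE //.
have := @diff_comp _ _ _ _ f LL x df (linear_differentiable (f x) cL).
rewrite diff_lin // => /(congr1 (fun F => F v)) /= ->.
by [].
Qed.

Lemma diff_row_sum (W : normedModType K) (psi : 'rV[K]_p -> W) y w :
  differentiable psi y -> 'd psi y w = \sum_(j < p) w 0 j *: 'D_(delta_mx 0 j) psi y.
Proof.
move=> dpsi; rewrite {1}[w]row_sum_delta linear_sum; apply: eq_bigr => j _.
by rewrite linearZ deriveE.
Qed.
End Rows.

(** * Calculus of C^k maps *)

Section CkCalculus.
Context {K : numFieldType} {V : normedModType K}.
Implicit Types (U : set V) (f g : V -> K).

(** Rules for derivatives hold only where the functions are differentiable, that is on [U], whereas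
    [Ck] speaks of the total function ['D_v f]. The rules for sums, products and composites are
    therefore proved up to equality on the open set [U]. *)
Lemma Ck_eq (W : normedModType K) U k (f g : V -> W) : open U ->
  (forall x, U x -> f x = g x) -> Ck k U f -> Ck k U g.
Proof.
move=> oU; elim: k f g => [|k IH] f g fg /=.
  move=> cf x Ux; rewrite /prop_for /continuous_at -(fg x Ux).
  apply: cvg_trans (cf x Ux); apply: near_eq_cvg.
  by near=> y; apply/fg; near: y; exact: open_nbhs_nbhs.
move=> [df Df]; split=> [x Ux|v].
  have nfg : \forall y \near x, f y = g y.
    by near=> y; apply/fg; near: y; exact: open_nbhs_nbhs.
  have d := df x Ux.
  suff : is_diff x g ('d f x) by case.
  apply: near_differentiable => [|e e0]; first exact: diff_continuous.
  have nfg0 : \forall h \near 0, f (x + h) = g (x + h).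
    have : (fun h => x + h) @ 0 --> x.
      by rewrite -[X in _ --> X]addr0; apply: cvgD; [exact: cvg_cst|exact: cvg_id].
    by move=> /(_ _ nfg).
  near=> h; rewrite -(near nfg0 h) // -(fg x Ux).
  by near: h; exact: differentiable_near.
apply: (IH ('D_v f) ('D_v g)) => // x Ux; apply: near_eq_derive.
by near=> y; apply/fg; near: y; exact: open_nbhs_nbhs.
Unshelve. all: by end_near. Qed.

Lemma CkW (W : normedModType K) U k (f : V -> W) : Ck k.+1 U f -> Ck k U f.
Proof.
elim: k f => [|k IH] f [df Df]; first by move=> x /df/differentiable_continuous.
by split=> // v; exact: IH.
Qed.

Lemma Ck_sub (W : normedModType K) U U' k (f : V -> W) : U' `<=` U -> Ck k U f -> Ck k U' f.
Proof.
move=> UU; elim: k f => [|k IH] f /=; first by move=> cf x /UU/cf.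
by move=> [df Df]; split=> [x /UU/df|v] //; exact: IH.
Qed.

Lemma Ck_cst (W : normedModType K) U k (c : W) : Ck k U (fun=> c).
Proof.
elim: k c => [|k IH] c /=; first by move=> x _; exact: cvg_cst.
split=> [x _|v]; first exact: differentiable_cst.
by rewrite (_ : 'D_v _ = fun=> 0) //; apply/funext => x; rewrite derive_cst.
Qed.

Lemma CkD U k f g : open U -> Ck k U f -> Ck k U g -> Ck k U (fun x => f x + g x).
Proof.
move=> oU; elim: k f g => [|k IH] f g /=.
  by move=> cf cg x Ux; apply: cvgD; [exact: cf|exact: cg].
move=> [df Df] [dg Dg]; split=> [x Ux|v].
  by apply: (@differentiableD _ _ _ f g); [exact: df|exact: dg].
apply: (@Ck_eq _ _ _ (fun x => 'D_v f x + 'D_v g x)) => //; last exact: IH.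
move=> x Ux; rewrite (@deriveD _ _ _ f g) //; apply: diff_derivable; [exact: df|exact: dg].
Qed.

Lemma CkM U k f g : open U -> Ck k U f -> Ck k U g -> Ck k U (fun x => f x * g x).
Proof.
move=> oU; elim: k f g => [|k IH] f g.
  by move=> cf cg x Ux; apply: cvgM; [exact: cf|exact: cg].
move=> Cf Cg; have [df Df] := Cf; have [dg Dg] := Cg; split=> [x Ux|v].
  by apply: (@differentiableM _ _ f g); [exact: df|exact: dg].
apply: (@Ck_eq _ _ _ (fun x => f x * 'D_v g x + g x * 'D_v f x)) => //.
  move=> x Ux; rewrite (@deriveM _ _ f g) //; apply: diff_derivable; [exact: df|exact: dg].
by apply: CkD => //; apply: IH; first [exact: CkW Cf|exact: CkW Cg|exact: Df|exact: Dg].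
Qed.

Lemma Ck_sum U k m (F : 'I_m -> V -> K) : open U -> (forall i, Ck k U (F i)) ->
  Ck k U (fun x => \sum_(i < m) F i x).
Proof.
move=> oU; elim: m F => [|m IH] F CF.
  by under eq_fun do rewrite big_ord0; exact: Ck_cst.
by under eq_fun do rewrite big_ord_recl; apply: CkD => //; apply: IH.
Qed.

Lemma Ck_rowP U k p (f : V -> 'rV[K]_p) : open U ->
  Ck k U f <-> forall j, Ck k U (fun x => f x 0 j).
Proof.
move=> oU; elim: k f => [|k IH] f /=.
  split=> [cf j x Ux|cf x Ux].
    by apply: (@continuous_comp _ _ _ f (fun M : 'rV[K]_p => M 0 j)); [exact: cf|exact: coord_continuous].
  have -> : f = fun x => \sum_(j < p) f x 0 j *: delta_mx 0 j.
    by apply/funext => y; rewrite [LHS]row_sum_delta.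
  rewrite /prop_for /continuous_at; elim: (index_enum _) => [|j s IHs].
    rewrite big_nil; under eq_fun do rewrite big_nil; exact: cvg_cst.
  rewrite big_cons; under eq_fun do rewrite big_cons; apply: cvgD => //.
  by apply: cvgZ; [exact: cf|exact: cvg_cst].
split=> [[df Df] j|H].
  split=> [x Ux|v]; first by apply: (differentiable_rowP f x).1; exact: df.
  apply: (@Ck_eq _ _ _ (fun x => 'D_v f x 0 j)) => //; last by move/IH: (Df v).
  by move=> x Ux; rewrite derive_row //; exact: df.
have df x : U x -> differentiable f x.
  by move=> Ux; apply/differentiable_rowP => j; have [d _] := H j; exact: d.
split=> // v; apply/IH => j.
apply: (@Ck_eq _ _ _ ('D_v (fun x => f x 0 j))) => //; last by have [_] := H j.
by move=> x Ux; rewrite derive_row //; exact: df.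
Qed.

(** By the chain rule ['D_v (psi \o f)] is a sum of products of components of ['D_v f] with partial
    derivatives of [psi] composed with [f]; the induction hypothesis covers the latter. *)
Lemma Ck_comp p U (U' : set 'rV[K]_p) k (psi : 'rV[K]_p -> K) (f : V -> 'rV[K]_p) :
  open U -> open U' -> (forall x, U x -> U' (f x)) ->
  Ck k U' psi -> Ck k U f -> Ck k U (psi \o f).
Proof.
move=> oU oU' ff; elim: k psi f ff => [|k IH] psi f ff.
  by move=> cpsi cf x Ux; apply: continuous_comp; [exact: cf|apply: cpsi; exact: ff].
move=> Cpsi Cf; have [dpsi Dpsi] := Cpsi; have [df Df] := Cf.
split=> [x Ux|v].
  by apply: differentiable_comp; [exact: df|apply: dpsi; exact: ff].
apply: (@Ck_eq _ _ _ (fun x => \sum_(j < p) 'D_v f x 0 j * ('D_(delta_mx 0 j) psi \o f) x)) => //.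
  move=> x Ux; have d1 := df x Ux; have d2 := dpsi _ (ff x Ux).
  rewrite [RHS]deriveE; last exact: differentiable_comp.
  by rewrite diff_comp //= diff_row_sum // deriveE.
apply: Ck_sum => // j; apply: CkM => //; first exact: ((Ck_rowP _ _ oU).1 (Df v) j).
exact: IH ff (Dpsi _) (CkW Cf).
Qed.

Lemma Ck_linear U k (L : {linear V -> K}) : continuous L -> Ck k U L.
Proof.
move=> cL; case: k => [|k] /=; first by move=> x _; exact: cL.
split=> [x _|v]; first exact: linear_differentiable.
rewrite (_ : 'D_v L = fun=> L v); first exact: Ck_cst.
by apply/funext => x; rewrite deriveE ?diff_lin //; exact: linear_differentiable.
Qed.
End CkCalculus.

(** * Goursat's lemma and the maximum principle *)

Section Goursat.
Context {R : realType}.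
Implicit Types (f g : R -> R) (a b c : R).

Definition itg a b f := \int[lebesgue_measure]_(x in `[a, b]) f x.

(** Continuity is two-sided even at the endpoints, so that subintervals inherit it without any
    one-sided limits. *)
Definition continuous_on_itv a b f :=
  forall x, a <= x <= b -> {for x, continuous f}.

Lemma continuous_on_itv_integrable a b f : continuous_on_itv a b f ->
  lebesgue_measure.-integrable `[a, b] (EFin \o f).
Proof.
move=> cf; apply: continuous_compact_integrable; first exact: segment_compact.
apply: continuous_in_subspaceT => x; rewrite inE /= in_itv /=; exact: cf.
Qed.

Lemma itg_split a b c f : a <= c <= b -> continuous_on_itv a b f ->
  itg a b f = itg a c f + itg c b f.
Proof.
move=> /andP[ac cb] cf; have fi := continuous_on_itv_integrable cf.
have ci : lebesgue_measure.-integrable `]c, b] (EFin \o f).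
  by apply: integrableS fi => //; apply: subset_itvr; rewrite bnd_simp.
rewrite /itg -(Rintegral_itv_obnd_cbnd ci) -(Rintegral_itvB (x := c) fi) ?bnd_simp //.
by rewrite addrC subrK.
Qed.

Lemma itgZ a b k f : continuous_on_itv a b f ->
  itg a b (fun x => k * f x) = k * itg a b f.
Proof.
by move=> cf; apply: RintegralZl => //; exact: continuous_on_itv_integrable.
Qed.

Lemma itgD a b f g : continuous_on_itv a b f -> continuous_on_itv a b g ->
  itg a b (fun x => f x + g x) = itg a b f + itg a b g.
Proof.
by move=> cf cg; apply: RintegralD => //; exact: continuous_on_itv_integrable.
Qed.

Lemma itg_cst a b k : a <= b -> itg a b (fun=> k) = k * (b - a).
Proof.
move=> ab; rewrite /itg Rintegral_cst //= lebesgue_measure_itv /= lte_fin.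
by move: ab; rewrite le_eqVlt => /predU1P[->|->]; rewrite ?ltxx ?subrr.
Qed.

Lemma le_itg a b f g : continuous_on_itv a b f -> continuous_on_itv a b g ->
  (forall x, a <= x <= b -> f x <= g x) -> itg a b f <= itg a b g.
Proof.
move=> cf cg fg; apply: le_Rintegral => //; exact: continuous_on_itv_integrable.
Qed.

Lemma itg_near_cst a b f k e : a <= b -> continuous_on_itv a b f ->
  (forall x, a <= x <= b -> `|f x - k| <= e) ->
  `|itg a b f - k * (b - a)| <= e * (b - a).
Proof.
move=> ab cf fk; rewrite ler_distl -mulrBl -mulrDl -!itg_cst //.
by apply/andP; split; apply: le_itg => //; (try by move=> ? _; apply: cst_continuous);
  move=> x /fk; rewrite ler_distl => /andP[].
Qed.

(** Total differentiability at [(x, y)] with partial derivatives [p] and [q], in the sum norm.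
    Nothing is said about how [p] and [q] depend on the point, which rules out Green's formula and
    calls for bisection. *)
Definition frechet2 (u : R -> R -> R) (x y p q : R) :=
  forall e, 0 < e -> exists2 d, 0 < d & forall h k, `|h| < d -> `|k| < d ->
    `|u (x + h) (y + k) - u x y - p * h - q * k| <= e * (`|h| + `|k|).

(** The circulation of [v dx + u dy] around the rectangle with lower left corner
    [(x, y)], width [w] and height [h]. *)
Definition flux (u v : R -> R -> R) x w y h :=
  itg y (y + h) (u (x + w)) - itg y (y + h) (u x)
  - (itg x (x + w) (v^~ (y + h)) - itg x (x + w) (v^~ y)).

Lemma frechet2_continuous1 u x y p q : frechet2 u x y p q ->
  {for x, continuous (u^~ y)}.
Proof.
move=> du; apply/cvgrPdist_le => e e0.
have [d d0 H] := du 1 ltr01.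
have c0 : 0 < `|p| + 1 by rewrite ltr_wpDl.
exists (Num.min d (e / (`|p| + 1))); first by rewrite /= lt_min d0 divr_gt0.
move=> z /=; rewrite lt_min => /andP[zd ze].
have := H (z - x) 0; rewrite [`|z - x|]distrC normr0 d0 mulr0 subr0 !addr0 mul1r.
rewrite subrKC zd => /(_ isT isT) Hz.
have Hp : `|x - z| * (`|p| + 1) < e by rewrite -ltr_pdivlMr.
have -> : u x y - u z y = - (u z y - u x y - p * (z - x)) + p * (x - z) by ring.
rewrite (le_trans (ler_normD _ _)) // normrN normrM.
by move: Hz Hp; nra.
Qed.

Lemma frechet2_swap u x y p q : frechet2 u x y p q ->
  frechet2 (fun a b => u b a) y x q p.
Proof.
move=> du e /du[d d0 H]; exists d => // h k hd kd.
by rewrite addrAC [`|h| + _]addrC; exact: H.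
Qed.

(** The edges inside the rectangle are traversed twice, in opposite directions. *)
Lemma flux_split (u v : R -> R -> R) x w y h : 0 <= w -> 0 <= h ->
  (forall s t, x <= s <= x + w -> y <= t <= y + h ->
     {for t, continuous (u s)} /\ {for s, continuous (v^~ t)}) ->
  flux u v x w y h =
    (flux u v x (w / 2) y (h / 2) + flux u v x (w / 2) (y + h / 2) (h / 2)) +
    (flux u v (x + w / 2) (w / 2) y (h / 2) +
     flux u v (x + w / 2) (w / 2) (y + h / 2) (h / 2)).
Proof.
move=> w0 h0 c; rewrite /flux -!addrA -!splitr.
have U s : x <= s <= x + w -> itg y (y + h) (u s) =
    itg y (y + h / 2) (u s) + itg (y + h / 2) (y + h) (u s).
  by move=> sx; apply: itg_split; [lra|move=> t ty; case: (c s t)].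
have V t : y <= t <= y + h -> itg x (x + w) (v^~ t) =
    itg x (x + w / 2) (v^~ t) + itg (x + w / 2) (x + w) (v^~ t).
  by move=> ty; apply: itg_split; [lra|move=> s sx; case: (c s t)].
rewrite !U ?V; try lra.
Qed.

(** The shared [p] is the point: it is the derivative of [u] in the first variable and of [v] in the
    second, so the affine parts contribute [p * w * h] to both differences of opposite edges and
    cancel. Each difference has an error of [2 * e * (w + h)] times the length of the edge. *)
Lemma flux_local (u v : R -> R -> R) x w y h xs ys p q q' e d : 0 < w -> 0 < h -> 0 < e ->
  x <= xs <= x + w -> y <= ys <= y + h -> w < d -> h < d ->
  (forall s t, x <= s <= x + w -> y <= t <= y + h ->
     {for t, continuous (u s)} /\ {for s, continuous (v^~ t)}) ->
  (forall h k, `|h| < d -> `|k| < d ->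
    `|u (xs + h) (ys + k) - u xs ys - p * h - q * k| <= e * (`|h| + `|k|)) ->
  (forall h k, `|h| < d -> `|k| < d ->
    `|v (xs + h) (ys + k) - v xs ys - q' * h - p * k| <= e * (`|h| + `|k|)) ->
  `|flux u v x w y h| <= 2 * e * (w + h) ^+ 2.
Proof.
move=> w0 h0 e0 xsx ysy wd hd c Hu Hv.
have uc s : x <= s <= x + w -> continuous_on_itv y (y + h) (u s).
  by move=> sx t ty; case: (c s t).
have vc t : y <= t <= y + h -> continuous_on_itv x (x + w) (v^~ t).
  by move=> ty s sx; case: (c s t).
have near_u s t : x <= s <= x + w -> y <= t <= y + h ->
   `|u s t - u xs ys - p * (s - xs) - q * (t - ys)| <= e * (w + h).
  move=> sx ty; have := Hu (s - xs) (t - ys); rewrite !subrKC.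
  have ws : `|s - xs| <= w by rewrite ler_norml; lra.
  have ht : `|t - ys| <= h by rewrite ler_norml; lra.
  move=> /(_ (le_lt_trans ws wd) (le_lt_trans ht hd)) /le_trans; apply.
  by rewrite ler_pM2l // lerD.
have near_v s t : x <= s <= x + w -> y <= t <= y + h ->
   `|v s t - v xs ys - q' * (s - xs) - p * (t - ys)| <= e * (w + h).
  move=> sx ty; have := Hv (s - xs) (t - ys); rewrite !subrKC.
  have ws : `|s - xs| <= w by rewrite ler_norml; lra.
  have ht : `|t - ys| <= h by rewrite ler_norml; lra.
  move=> /(_ (le_lt_trans ws wd) (le_lt_trans ht hd)) /le_trans; apply.
  by rewrite ler_pM2l // lerD.
have I1 : `|itg y (y + h) (fun t => u (x + w) t + (-1) * u x t) - p * w * (y + h - y)|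
     <= (2 * e * (w + h)) * (y + h - y).
  apply: itg_near_cst; first lra.
    move=> t ty; apply: cvgD; first by apply: (uc (x + w)) => //; lra.
    by apply: cvgMl_tmp; apply: (uc x) => //; lra.
  move=> t ty; have := near_u (x + w) t; have := near_u x t.
  rewrite !ler_norml => /(_ _ ty) A /(_ _ ty) B; move: A B; nra.
have I2 : `|itg x (x + w) (fun s => v s (y + h) + (-1) * v s y) - p * h * (x + w - x)|
     <= (2 * e * (w + h)) * (x + w - x).
  apply: itg_near_cst; first lra.
    move=> s sx; apply: cvgD; first by apply: (vc (y + h)) => //; lra.
    by apply: cvgMl_tmp; apply: (vc y) => //; lra.
  move=> s sx; have := near_v s (y + h); have := near_v s y.
  rewrite !ler_norml => /(_ sx) A /(_ sx) B; move: A B; nra.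
move: I1 I2; rewrite !itgD ?itgZ; first last.
all: try by (try move=> ? ?; try apply: cvgMl_tmp; (apply: vc || apply: uc) => //; lra).
by rewrite /flux !ler_norml !mulN1r; nra.
Qed.
End Goursat.

Section GoursatRectangle.
Context {R : realType}.
Variables (u v : R -> R -> R) (x0 w y0 h : R).
Hypotheses (w0 : 0 < w) (h0 : 0 < h).
Hypothesis duv : forall s t, x0 <= s <= x0 + w -> y0 <= t <= y0 + h ->
  exists p q q', frechet2 u s t p q /\ frechet2 v s t q' p.

Let cuv s t : x0 <= s <= x0 + w -> y0 <= t <= y0 + h ->
  {for t, continuous (u s)} /\ {for s, continuous (v^~ t)}.
Proof.
move=> sx ty; have [p [q [q' [du dv]]]] := duv sx ty; split.
  exact: (frechet2_continuous1 (frechet2_swap du)).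
exact: frechet2_continuous1 dv.
Qed.

Let half n : w / 2 ^+ n / 2 = w / 2 ^+ n.+1.
Proof. by rewrite exprSr invfM mulrA. Qed.
Let halfh n : h / 2 ^+ n / 2 = h / 2 ^+ n.+1.
Proof. by rewrite exprSr invfM mulrA. Qed.

Let bad (n : nat) (z : R * R) :=
  [/\ x0 <= z.1 /\ z.1 + w / 2 ^+ n <= x0 + w,
      y0 <= z.2 /\ z.2 + h / 2 ^+ n <= y0 + h &
      `|flux u v x0 w y0 h| / 4 ^+ n <=
      `|flux u v z.1 (w / 2 ^+ n) z.2 (h / 2 ^+ n)|].

Let sub (n : nat) (z z' : R * R) :=
  [/\ z.1 <= z'.1 /\ z'.1 + w / 2 ^+ n.+1 <= z.1 + w / 2 ^+ n &
      z.2 <= z'.2 /\ z'.2 + h / 2 ^+ n.+1 <= z.2 + h / 2 ^+ n].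

(** One of the four quarters carries at least a quarter of the circulation. The premise [bad] stands
    inside the existential so that [choice] yields a total successor function. *)
Let step (nz : nat * (R * R)) : exists z',
  bad nz.1 nz.2 -> bad nz.1.+1 z' /\ sub nz.1 nz.2 z'.
Proof.
case: nz => n [x y] /=; have [|nb] := pselect (bad n (x, y)); last by exists (x, y).
move=> [/= [xl xr] [yl yr]].
have wn0 : 0 < w / 2 ^+ n by rewrite divr_gt0 ?exprn_gt0.
have hn0 : 0 < h / 2 ^+ n by rewrite divr_gt0 ?exprn_gt0.
rewrite [flux _ _ x _ _ _]flux_split ?(ltW wn0) ?(ltW hn0) //; last first.
  by move=> s t sx ty; apply: cuv; lra.
set k := `|flux u v x0 w y0 h|; set f1 := flux _ _ _ _ _ _.
set f2 := flux _ _ _ _ (y + _) _; set f3 := flux _ _ (x + _) _ _ _.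
set f4 := flux _ _ (x + _) _ (y + _) _ => Hk.
have Hk4 : k / 4 ^+ n = k / 4 ^+ n.+1 + k / 4 ^+ n.+1 + (k / 4 ^+ n.+1 + k / 4 ^+ n.+1).
  by rewrite exprSr invfM; field; rewrite expf_neq0.
have [H1|H1] := leP (k / 4 ^+ n.+1) `|f1|.
  by exists (x, y) => _; rewrite /bad /sub /= -half -halfh; do !split => //; lra.
have [H2|H2] := leP (k / 4 ^+ n.+1) `|f2|.
  by exists (x, y + h / 2 ^+ n / 2) => _; rewrite /bad /sub /= -half -halfh; do !split => //; lra.
have [H3|H3] := leP (k / 4 ^+ n.+1) `|f3|.
  by exists (x + w / 2 ^+ n / 2, y) => _; rewrite /bad /sub /= -half -halfh; do !split => //; lra.
have [H4|H4] := leP (k / 4 ^+ n.+1) `|f4|.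
  by exists (x + w / 2 ^+ n / 2, y + h / 2 ^+ n / 2) => _; rewrite /bad /sub /= -half -halfh; do !split => //; lra.
have := ler_normD (f1 + f2) (f3 + f4); have := ler_normD f1 f2; have := ler_normD f3 f4.
by move=> *; exfalso; lra.
Qed.

(** Every left end lies below every right end, so the supremum of the left ends belongs to all the
    intervals. *)
Let nested_sup (x : nat -> R) (l : R) :
  (forall n, x n <= x n.+1 /\ x n.+1 + l / 2 ^+ n.+1 <= x n + l / 2 ^+ n) -> 0 < l ->
  exists xs, forall n, x n <= xs <= x n + l / 2 ^+ n.
Proof.
move=> H l0.
have inc m n : (m <= n)%N -> x m <= x n /\ x n + l / 2 ^+ n <= x m + l / 2 ^+ m.
  elim: n => [|n IH]; first by rewrite leqn0 => /eqP ->.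
  rewrite leq_eqVlt => /predU1P[->//|/IH [A B]].
  have [C D] := H n; split; first exact: le_trans C.
  exact: le_trans B.
have pos n : 0 < l / 2 ^+ n by rewrite divr_gt0 ?exprn_gt0.
have ub n : ubound (range x) (x n + l / 2 ^+ n).
  move=> _ [m _ <-]; have [mn|/ltnW nm] := leqP m n.
    by apply: (le_trans (inc _ _ mn).1); rewrite lerDl ltW.
  by apply: le_trans (inc _ _ nm).2; rewrite lerDl ltW.
exists (sup (range x)) => n; apply/andP; split.
  by apply: ub_le_sup; [exists (x 0%N + l / 2 ^+ 0) | exists n].
by apply: ge_sup => //; exists (x 0%N), 0%N.
Qed.

Theorem goursat_rectangle : flux u v x0 w y0 h = 0.
Proof.
apply/eqP; rewrite -normr_le0 leNgt; apply/negP => k0.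
have [nxt Hnxt] := choice step.
pose z := fix z n := if n is m.+1 then nxt (m, z m) else (x0, y0).
have Hz n : bad n (z n).
  elim: n => [|n IH]; last exact: (Hnxt (n, z n) IH).1.
  by rewrite /bad /= !expr0 !divr1; do !split.
have Hs n : sub n (z n) (z n.+1) by exact: (Hnxt (n, z n) (Hz n)).2.
have [xs Hxs] : exists xs, forall n, (z n).1 <= xs <= (z n).1 + w / 2 ^+ n.
  by apply: nested_sup => // n; case: (Hs n).
have [ys Hys] : exists ys, forall n, (z n).2 <= ys <= (z n).2 + h / 2 ^+ n.
  by apply: nested_sup => // n; case: (Hs n).
have [p [q [q' [du dv]]]] : exists p q q', frechet2 u xs ys p q /\ frechet2 v xs ys q' p.
  by apply: duv; [have := Hxs 0%N|have := Hys 0%N]; rewrite /= expr0 divr1.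
set k := `|flux u v x0 w y0 h| in k0.
(* With this value [flux_local] bounds the circulation around the n-th rectangle by
   [k / 2 / 4 ^+ n], half of what [bad] guarantees. *)
pose e := k / (4 * (w + h) ^+ 2).
have e0 : 0 < e by rewrite divr_gt0 // mulr_gt0 // exprn_gt0 // addr_gt0.
have [d1 d10 H1] := du e e0; have [d2 d20 H2] := dv e e0.
pose d := Num.min d1 d2; have d0 : 0 < d by rewrite lt_min d10.
have [n Hn] : exists n, (w + h) / 2 ^+ n < d.
  have wh0 : 0 < w + h by rewrite addr_gt0.
  exists (Num.bound ((w + h) / d)); rewrite ltr_pdivrMr ?exprn_gt0 // mulrC -ltr_pdivrMr //.
  apply: lt_le_trans (_ : (Num.bound ((w + h) / d))%:R <= _).
    by apply: archi_boundP; rewrite divr_ge0 // ltW.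
  by rewrite -natrX ler_nat ltnW // ltn_expl.
have [[xl xr] [yl yr] B] := Hz n.
have wn0 : 0 < w / 2 ^+ n by rewrite divr_gt0 ?exprn_gt0.
have hn0 : 0 < h / 2 ^+ n by rewrite divr_gt0 ?exprn_gt0.
rewrite mulrDl in Hn.
have wd : w / 2 ^+ n < d by lra.
have hd : h / 2 ^+ n < d by lra.
have B2 : `|flux u v (z n).1 (w / 2 ^+ n) (z n).2 (h / 2 ^+ n)|
    <= 2 * e * (w / 2 ^+ n + h / 2 ^+ n) ^+ 2.
  apply: (flux_local (xs := xs) (ys := ys) (p := p) (q := q) (q' := q') (d := d)) => //.
  - by move=> s t sx ty; apply: cuv; lra.
  - by move=> a b; rewrite /d !lt_min => /andP[? _] /andP[? _]; apply: H1.
  - by move=> a b; rewrite /d !lt_min => /andP[_ ?] /andP[_ ?]; apply: H2.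
have := le_trans B B2; apply/negP; rewrite -ltNge.
rewrite -/k -mulrDl expr_div_n exprAC -[2 ^+ 2]natrX mulrA.
rewrite ltr_pM2r ?invr_gt0 ?exprn_gt0 // /e.
have -> : 2 * (k / (4 * (w + h) ^+ 2)) * (w + h) ^+ 2 = k / 2.
  by field; rewrite gt_eqF // addr_gt0.
by rewrite ltr_pdivrMr //; lra.
Qed.

End GoursatRectangle.

(** * Differentials in two real variables and the Cauchy-Riemann equations *)

Section Frechet.
Import ComplexField.
Local Open Scope complex_scope.
Context {R : realType}.
Implicit Types (x y p q a b : R) (u f g : R -> R -> R).

Lemma frechet2_comp (u f g : R -> R -> R) x y p q pf qf pg qg :
  frechet2 u (f x y) (g x y) p q -> frechet2 f x y pf qf -> frechet2 g x y pg qg ->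
  frechet2 (fun a b => u (f a b) (g a b)) x y
    (p * pf + q * pg) (p * qf + q * qg).
Proof.
move=> du df dg e e0.
(* Once [e1 <= 1], the increments of [f] and [g] are at most [c * n], so the outer error
   [e / (4 * c)] costs [e / 2]. The other bound on [e1] keeps the inner errors, weighted by [p] and
   [q], within the remaining [e / 2]. *)
pose c := `|pf| + `|qf| + `|pg| + `|qg| + 1.
have c0 : 0 < c by rewrite ltr_wpDl // !addr_ge0.
have [d d0 Hu] := du (e / (4 * c)) (divr_gt0 e0 (mulr_gt0 (ltr0n _ 4) c0)).
pose e1 := Num.min 1 (e / (2 * (`|p| + `|q| + 1))).
have m0 : 0 < `|p| + `|q| + 1 by rewrite ltr_wpDl // addr_ge0.
have e10 : 0 < e1 by rewrite lt_min ltr01 divr_gt0 // mulr_gt0.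
have [df0 df00 Hf] := df e1 e10; have [dg0 dg00 Hg] := dg e1 e10.
exists (Num.min (Num.min df0 dg0) (d / (2 * c))).
  by rewrite !lt_min df00 dg00 divr_gt0 // mulr_gt0.
move=> h k; rewrite !lt_min => /andP[/andP[hf hg] hd] /andP[/andP[kf kg] kd].
have := Hf h k hf kf; have := Hg h k hg kg => {Hf Hg}.
set A := f (x + h) (y + k); set B := g (x + h) (y + k) => HB HA.
set n := `|h| + `|k| in HA HB *.
have n0 : 0 <= n by rewrite addr_ge0.
have e11 : e1 <= 1 by rewrite ge_min lexx.
have lin s t : `|s * h + t * k| <= (`|s| + `|t|) * n.
  rewrite (le_trans (ler_normD _ _)) // !normrM /n.
  by have := normr_ge0 s; have := normr_ge0 t; have := normr_ge0 h; have := normr_ge0 k; nra.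
have bnd D s t : `|D - s * h - t * k| <= e1 * n -> `|s| + `|t| + 1 <= c -> `|D| <= c * n.
  move=> HD stc; have -> : D = (D - s * h - t * k) + (s * h + t * k) by ring.
  rewrite (le_trans (ler_normD _ _)) // (le_trans (lerD HD (lin s t))) //.
  by rewrite -mulrDl ler_wpM2r //; lra.
have pf0 := normr_ge0 pf; have qf0 := normr_ge0 qf.
have pg0 := normr_ge0 pg; have qg0 := normr_ge0 qg.
have HA1 : `|A - f x y| <= c * n by apply: bnd HA _; rewrite /c; lra.
have HB1 : `|B - g x y| <= c * n by apply: bnd HB _; rewrite /c; lra.
have nd : c * n < d.
  by move: hd kd; rewrite !ltr_pdivlMr ?mulr_gt0 // /n => hd kd; nra.
have := Hu (A - f x y) (B - g x y) (le_lt_trans HA1 nd) (le_lt_trans HB1 nd).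
rewrite !subrKC => HU.
have HU' : `|u A B - u (f x y) (g x y) - p * (A - f x y) - q * (B - g x y)| <= e / 2 * n.
  apply: (le_trans HU); apply: (@le_trans _ _ (e / (4 * c) * (c * n + c * n))).
    by rewrite ler_pM2l ?divr_gt0 ?mulr_gt0 // lerD.
  rewrite le_eqVlt; apply/orP; left; apply/eqP; field.
  by rewrite gt_eqF.
have -> : u A B - u (f x y) (g x y) - (p * pf + q * pg) * h - (p * qf + q * qg) * k =
  (u A B - u (f x y) (g x y) - p * (A - f x y) - q * (B - g x y)) +
  (p * (A - f x y - pf * h - qf * k) + q * (B - g x y - pg * h - qg * k)) by ring.
rewrite (le_trans (ler_normD _ _)) // [e in e * n]splitr mulrDl lerD //.
rewrite (le_trans (ler_normD _ _)) // !normrM.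
have : (`|p| + `|q|) * e1 <= e / 2.
  apply: (@le_trans _ _ ((`|p| + `|q| + 1) * (e / (2 * (`|p| + `|q| + 1))))).
    by apply: ler_pM => //; rewrite ?addr_ge0 ?(ltW e10) // ?lerDl // ge_min lexx orbT.
  by rewrite le_eqVlt; apply/orP; left; apply/eqP; field; rewrite gt_eqF.
move=> H; apply: (@le_trans _ _ ((`|p| + `|q|) * e1 * n)).
  by rewrite -mulrA mulrDl lerD // ler_wpM2l.
by rewrite ler_wpM2r.
Qed.

Lemma frechet2_mul f g x y pf qf pg qg :
  frechet2 f x y pf qf -> frechet2 g x y pg qg ->
  frechet2 (fun a b => f a b * g a b) x y
    (g x y * pf + f x y * pg) (g x y * qf + f x y * qg).
Proof.
move=> df dg; apply: (frechet2_comp (u := fun a b => a * b)) => // e e0.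
exists e => // h k he ke.
have -> : (f x y + h) * (g x y + k) - f x y * g x y - g x y * h - f x y * k = h * k by ring.
by rewrite normrM; have := normr_ge0 h; have := normr_ge0 k; nra.
Qed.

Lemma frechet2_affine f a x y p q : frechet2 f x y p q ->
  frechet2 (fun s t => a + f s t) x y p q.
Proof.
move=> df e /df [d d0 H]; exists d => // h k hd kd.
have -> : a + f (x + h) (y + k) - (a + f x y) = f (x + h) (y + k) - f x y by ring.
exact: H.
Qed.

Lemma frechet2_derive1 (f : R -> R) x y d : is_derive x 1 f d ->
  frechet2 (fun s _ => f s) x y d 0.
Proof.
move=> [fd <-] e e0; have /derivable1_diffP df := fd.
have /nbhs_ballP[r /= r0 H] := differentiable_near df e0.
exists r => // h k hr _; have := H h; rewrite /ball /= sub0r normrN => /(_ hr).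
have -> : 'd f x h = h * 'D_1 f x.
  by rewrite deriveE // -[in LHS](mulr1 h) -[h * 1]/(h *: 1) linearZ.
move=> Hh.
rewrite mul0r subr0 mulrC (le_trans Hh) // ler_wpM2l ?(ltW e0) //.
by rewrite lerDl.
Qed.

Lemma normc_normE (z : R[i]) : `|z| = (Normc.normc z)%:C.
Proof. by rewrite normc_def; case: z. Qed.

Lemma normc_le (z : R[i]) : Normc.normc z <= `|complex.Re z| + `|complex.Im z|.
Proof.
rewrite [z in leLHS]complexE (le_trans (le_normcD _ _)) // Normc.normcM /=.
by rewrite !expr0n /= !addr0 !add0r expr1n !sqrtr_sqr sqrtr1 mul1r.
Qed.

Lemma normc_ge (z : R[i]) :
  `|complex.Re z| <= Normc.normc z /\ `|complex.Im z| <= Normc.normc z.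
Proof.
case: z => a b /=; split; rewrite -sqrtr_sqr ler_wsqrtr //.
  by rewrite lerDl sqr_ge0.
by rewrite lerDr sqr_ge0.
Qed.

Local Notation C := (scalar_field R Complexes).

(** The derivative is multiplication by some [l = p + i q], and [l * (h + i k)] has real part
    [p h - q k] and imaginary part [q h + p k]. *)
Lemma frechet2_complex (H : C -> C) (x y : R) :
  differentiable H (x +i* y : C) ->
  exists p q, frechet2 (fun a b => complex.Re (H (a +i* b))) x y p (- q) /\
              frechet2 (fun a b => complex.Im (H (a +i* b))) x y q p.
Proof.
move=> dH; pose l := 'd H (x +i* y : C) 1.
have dE h : 'd H (x +i* y : C) h = h * l by rewrite -[h in LHS]mulr1 -[h * 1]/(h *: 1) linearZ.
exists (complex.Re l), (complex.Im l).
have key (e : R) : 0 < e -> exists2 d : R, 0 < d & forall h k : R, `|h| < d -> `|k| < d ->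
   Normc.normc (H ((x + h) +i* (y + k)) - H (x +i* y) - (h +i* k) * l) <= e * (`|h| + `|k|).
  move=> e0; have e0C : 0 < e%:C by rewrite ltcR.
  have /nbhs_ballP[r /= r0 Hr] := differentiable_near dH e0C.
  move: r r0 Hr => [r ri]; rewrite ltcE /= => /andP[/eqP -> r0] Hr.
  exists (r / 2); first by rewrite divr_gt0.
  move=> h k hr kr; have := Hr (h +i* k); rewrite /ball /= sub0r normrN dE.
  have nb : Normc.normc (h +i* k) <= `|h| + `|k| by exact: normc_le.
  rewrite !normc_normE -rmorphM !lecR ltcR => /(_ _)/le_trans; apply; first lra.
  by rewrite ler_pM2l.
clearbody l; clear dE; split=> e e0; have [d d0 Hd] := key e e0; exists d => // h k hd kd;
  (apply: le_trans (Hd h k hd kd)).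
  apply: le_trans (normc_ge _).1.
  rewrite le_eqVlt; apply/orP; left; apply/eqP; congr `|_|.
  case: (H _) => ? ?; case: (H _) => ? ?; case: l {key Hd} => ? ? /=; ring.
apply: le_trans (normc_ge _).2.
rewrite le_eqVlt; apply/orP; left; apply/eqP; congr `|_|.
case: (H _) => ? ?; case: (H _) => ? ?; case: l {key Hd} => ? ? /=; ring.
Qed.

End Frechet.

(** * Means over circles *)

Section MaxPrinciple.
Import ComplexField.
Local Open Scope complex_scope.
Context {R : realType}.
Local Notation C := (scalar_field R Complexes).

Lemma continuous_on_itv_frechet2 (f : R -> R -> R) a b r :
  (forall t, exists p q, frechet2 f r t p q) -> continuous_on_itv a b (f r).
Proof.
by move=> df t _; have [p [q H]] := df t; exact: (frechet2_continuous1 (frechet2_swap H)).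
Qed.

(** In polar coordinates around [x0 + i y0] the Cauchy-Riemann equation reads
    [d_r (Re H) = d_t (Im H / r)], so by Goursat the integral of [Re H] over the
    circle of radius [r] does not depend on [r]. *)
Lemma no_strict_local_max (H : C -> C) (x0 y0 rho eps : R) : 0 < rho -> 0 < eps ->
  (forall x y, x ^+ 2 + y ^+ 2 <= rho ^+ 2 ->
     differentiable H ((x0 + x) +i* (y0 + y) : C) /\
     complex.Re (H ((x0 + x) +i* (y0 + y))) <=
       complex.Re (H (x0 +i* y0)) - eps * (x ^+ 2 + y ^+ 2)) -> False.
Proof.
move=> rho0 eps0 HH.
pose X (r t : R) := x0 + r * cos t; pose Y (r t : R) := y0 + r * sin t.
pose U r t := complex.Re (H (X r t +i* Y r t)).
pose V r t := complex.Im (H (X r t +i* Y r t)) * r^-1.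
have sq r t : (r * cos t) ^+ 2 + (r * sin t) ^+ 2 = r ^+ 2.
  by rewrite !exprMn -mulrDr cos2Dsin2 mulr1.
have dX r t : frechet2 X r t (cos t) (- (r * sin t)).
  have := frechet2_affine x0 (frechet2_mul (frechet2_derive1 t (is_derive_id r 1))
     (frechet2_swap (frechet2_derive1 r (is_derive_cos t)))).
  by rewrite mulr1 !mulr0 addr0 add0r mulrN.
have dY r t : frechet2 Y r t (sin t) (r * cos t).
  have := frechet2_affine y0 (frechet2_mul (frechet2_derive1 t (is_derive_id r 1))
     (frechet2_swap (frechet2_derive1 r (is_derive_sin t)))).
  by rewrite mulr1 !mulr0 addr0 add0r.
have dUV r t : 0 < r <= rho -> exists p q q', frechet2 U r t p q /\ frechet2 V r t q' p.
  move=> /andP[r0 rrho].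
  have [|dH _] := HH (r * cos t) (r * sin t).
    by rewrite sq ler_pXn2r // ?nnegrE ltW.
  have [p [q [dre dim]]] := frechet2_complex dH.
  rewrite -/(X r t) -/(Y r t) in dre dim.
  have du := frechet2_comp dre (dX r t) (dY r t).
  have dv := frechet2_comp dim (dX r t) (dY r t).
  have dinv : is_derive r 1 (fun s : R => s^-1) (- r ^- 2).
    have r_neq0 : r != 0 by rewrite gt_eqF.
    split; first exact: (@derivableV _ _ id).
    by rewrite (@deriveV _ _ id) // derive_id [_ *: _]mulr1.
  have dw := frechet2_mul dv (frechet2_derive1 t dinv).
  do 3! eexists; split; first exact: du.
  have -> : p * cos t + (- q) * sin t = r^-1 * (q * - (r * sin t) + p * (r * cos t)) +
     complex.Im (H (X r t +i* Y r t)) * 0.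
    by field; rewrite gt_eqF.
  exact: dw.
have cU r : 0 < r <= rho -> continuous_on_itv 0 (0 + pi *+ 2) (U r).
  move=> rr; apply: continuous_on_itv_frechet2 => t.
  by have [p [q [_ [D _]]]] := dUV r t rr; exists p, q.
have pi20 : 0 < pi *+ 2 :> R by rewrite mulrn_wgt0 // pi_gt0.
have const r : 0 < r < rho -> itg 0 (0 + pi *+ 2) (U rho) = itg 0 (0 + pi *+ 2) (U r).
  move=> /andP[r0 rrho].
  have := @goursat_rectangle R U V r (rho - r) 0 (pi *+ 2).
  rewrite subr_gt0 /flux => /(_ rrho pi20).
  (* By periodicity the edges [t = 0] and [t = 2 pi] cancel; what is left are the integrals over the
     circles of radii [r] and [rho]. *)
  have -> : V^~ (0 + pi *+ 2) = V^~ 0.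
    by apply/funext => s; rewrite /V /X /Y add0r cos2pi sin2pi cos0 sin0.
  rewrite subrr subr0 subrKC => K; apply/subr0_eq/K => s t /andP[rs srho] _.
  by apply: dUV; rewrite srho (lt_le_trans r0).
have Hrho : itg 0 (0 + pi *+ 2) (U rho) <=
   (complex.Re (H (x0 +i* y0)) - eps * rho ^+ 2) * (0 + pi *+ 2 - 0).
  rewrite -itg_cst; last by rewrite add0r ltW.
  apply: le_itg.
  - by apply: cU; rewrite rho0 lexx.
  - by move=> ? _; exact: cst_continuous.
  - move=> t _; have [|_] := HH (rho * cos t) (rho * sin t); first by rewrite sq.
    by rewrite sq.
have [|dH _] := HH 0 0; first by rewrite expr0n addr0 sqr_ge0.
rewrite !addr0 in dH.
have [p [q [dre _]]] := frechet2_complex dH.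
have [d d0 Hd] := dre 1 ltr01.
pose c := 2 + `|p| + `|q|.
have c0 : 0 < c by rewrite /c -addrA ltr_wpDr // addr_ge0.
(* The factor [r^-1] in [V] excludes radius 0, so a small circle stands in for the centre. There
   [U r] falls below the central value by at most [c * r], the [2] in [c] absorbing the error term,
   and [r] makes this at most half of the drop [eps * rho ^+ 2] on the large circle. *)
pose r := Num.min (Num.min (rho / 2) (d / 2)) (eps * rho ^+ 2 / (2 * c)).
have er0 : 0 < eps * rho ^+ 2 by rewrite mulr_gt0 // exprn_gt0.
have r0 : 0 < r by rewrite !lt_min !divr_gt0 // mulr_gt0.
have rrho : r < rho.
  apply: (@le_lt_trans _ _ (rho / 2)); first by rewrite !ge_min lexx.
  lra.
have rd : r < d.
  apply: (@le_lt_trans _ _ (d / 2)); first by rewrite !ge_min lexx orbT.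
  lra.
have rc : c * r <= eps * rho ^+ 2 / 2.
  apply: (@le_trans _ _ (c * (eps * rho ^+ 2 / (2 * c)))).
    by rewrite ler_pM2l // !ge_min lexx !orbT.
  by rewrite le_eqVlt; apply/orP; left; apply/eqP; field; rewrite gt_eqF.
have Hr : (complex.Re (H (x0 +i* y0)) - eps * rho ^+ 2 / 2) * (0 + pi *+ 2 - 0)
   <= itg 0 (0 + pi *+ 2) (U r).
  rewrite -itg_cst; last by rewrite add0r ltW.
  apply: le_itg.
  - by move=> ? _; exact: cst_continuous.
  - by apply: cU; rewrite r0 ltW.
  - move=> t _.
    have rr s : `|s| <= 1 -> `|r * s| <= r.
      by move=> s1; rewrite normrM (gtr0_norm r0) ler_piMr // ltW.
    have rcos := rr _ (cos_max t); have rsin := rr _ (sin_max t).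
    have := Hd (r * cos t) (r * sin t) (le_lt_trans rcos rd) (le_lt_trans rsin rd).
    rewrite -/(X r t) -/(Y r t) -/(U r t).
    have P := ler_norm (- (p * (r * cos t))); have Q := ler_norm ((q * (r * sin t))).
    have PP : `|- (p * (r * cos t))| <= `|p| * r by rewrite normrN normrM ler_wpM2l.
    have QQ : `|(q * (r * sin t))| <= `|q| * r by rewrite normrM ler_wpM2l.
    by rewrite ler_norml mul1r => /andP[A _]; move: rc; rewrite /c; lra.
have := const r; rewrite r0 rrho => /(_ isT) E; rewrite E in Hrho.
have := le_trans Hr Hrho; rewrite ler_pM2r; last by rewrite add0r subr0.
by move: er0; lra.
Qed.
End MaxPrinciple.

(** * The maximum principle on a square *)

Section MaxPrincipleSquare.
Import ComplexField.
Local Open Scope complex_scope.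
Context {R : realType}.
Local Notation C := (scalar_field R Complexes).
Local Notation nc := (@Normc.normc R).
Implicit Types (z w p : C) (F G : C -> C).

Lemma nbhsCP z (A : set C) :
  nbhs z A <-> exists2 d : R, 0 < d & forall h : C, nc h < d -> A (z + h).
Proof.
split.
  move=> /nbhs_ballP[[d di]]; rewrite /= ltcE /= => /andP[/eqP -> d0] H.
  exists d => // h hd; apply: H; rewrite /ball /= opprD addrA subrr add0r normrN.
  by rewrite normc_normE ltcR.
move=> [d d0 H]; apply/nbhs_ballP; exists (d%:C); first by rewrite /= ltcR.
move=> y; rewrite /ball /= distrC normc_normE ltcR => /H.
by rewrite subrKC.
Qed.

Lemma continuousCP G z : {for z, continuous G} <->
  (forall e : R, 0 < e -> exists2 d : R, 0 < d &
     forall h : C, nc h < d -> nc (G (z + h) - G z) <= e).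
Proof.
split=> [cG e e0|H].
  have e0C : 0 < (e%:C : C) by rewrite ltcR.
  have /cvgrPdist_le/(_ _ e0C)/nbhsCP[d d0 Hd] := cG.
  by exists d => // h /Hd /=; rewrite distrC normc_normE lecR.
apply/(@cvgrPdist_le _ _ _ (nbhs z)) => -[e ei]; rewrite ltcE /= => /andP[/eqP -> /H[d d0 Hd]].
by apply/nbhsCP; exists d => // h /Hd; rewrite distrC normc_normE lecR.
Qed.

Lemma differentiableCP G z : differentiable G z ->
  forall e : R, 0 < e -> exists2 d : R, 0 < d &
     forall h : C, nc h < d -> nc (G (z + h) - G z - h * 'd G z 1) <= e * nc h.
Proof.
move=> dG e e0; have e0C : 0 < (e%:C : C) by rewrite ltcR.
have /nbhsCP[d d0 Hd] := differentiable_near dG e0C.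
exists d => // h /Hd; rewrite add0r !normc_normE -rmorphM lecR.
by rewrite diff_scale1.
Qed.

(** A square rather than a disc, since its compactness is that of a product of two intervals. *)
Definition square : set C := [set z | `|complex.Re z| <= 1 /\ `|complex.Im z| <= 1].
Definition square_boundary : set C :=
  [set z | square z /\ (`|complex.Re z| = 1 \/ `|complex.Im z| = 1)].

(** If [N = |G z1|] exceeded [m], multiplying [G] by the conjugate [lam] of [G z1] would give a
    function with real part [N ^+ 2] at [z1]; a maximum of this real part plus [eps |z|^2] is then
    refuted by [no_strict_local_max]. Points where [G] is only continuous do no harm: [G] vanishes
    there, so they are not the maximum. *)
Lemma max_principle_continuous G p1 p2 (m : R) :
  (forall z, square z -> z != p1 -> z != p2 -> differentiable G z) ->
  (forall z, square z -> (z == p1) || (z == p2) -> G z = 0 /\ {for z, continuous G}) ->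
  (forall z, square_boundary z -> nc (G z) <= m) ->
  forall z, square z -> nc (G z) <= m.
Proof.
move=> dG G0 Gm z1 z1Q; rewrite leNgt; apply/negP => mN.
have ncge0 (z : C) : 0 <= nc z by case: z => ? ?; exact: sqrtr_ge0.
have m0 : 0 <= m.
  apply: le_trans (ncge0 _) (Gm 1 _); split; last by left => /=; rewrite normr1.
  by split; rewrite /= ?normr1 ?normr0.
set N := nc (G z1) in mN.
have N0 : 0 < N by apply: le_lt_trans mN.
pose lam : C := (complex.Re (G z1)) -i* (complex.Im (G z1)).
have lamN : nc lam = N by rewrite /N /=; case: (G z1) => a b /=; rewrite sqrrN.
(* As [|z|^2 <= 2] on the square, a point with [psi <= N * m] has [phi <= N * m + 2 * eps < N ^+ 2
   <= max phi]. This keeps the maximum away from the boundary and from [p1] and [p2]. *)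
pose eps := (N ^+ 2 - N * m) / 4.
have eps0 : 0 < eps by rewrite divr_gt0 // subr_gt0 expr2 ltr_pM2l.
pose psi z := complex.Re (lam * G z).
have psi_le z : psi z <= N * nc (G z).
  by rewrite -lamN -Normc.normcM (le_trans (ler_norm _)) // (normc_ge _).1.
have psi1 : psi z1 = N ^+ 2.
  rewrite /psi /N /lam; case: (G z1) => a b /=; rewrite sqr_sqrtr ?addr_ge0 ?sqr_ge0 //.
  by ring.
pose phi (z : R * R) := psi (z.1 +i* z.2) + eps * (z.1 ^+ 2 + z.2 ^+ 2).
have cG z : square z -> {for z, continuous G}.
  move=> zQ; have [zp|] := boolP ((z == p1) || (z == p2)); first exact: (G0 z zQ zp).2.
  by rewrite negb_or => /andP[a b]; apply/differentiable_continuous/dG.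
pose Q := (`[-1, 1] `*` `[-1, 1] : set (R * R)).
have QP (z : R * R) : Q z <-> square (z.1 +i* z.2).
  rewrite /Q /square /= !in_itv /= -!ler_norml; split.
    by move=> [].
  by move=> [].
have cphi : {within Q, continuous phi}.
  apply: continuous_in_subspaceT => -[x y]; rewrite inE => /QP /= xyQ.
  apply: cvgD.
    apply/cvgrPdist_le => e e0.
    have [d d0 Hd] := (continuousCP G _).1 (cG _ xyQ) (e / N) (divr_gt0 e0 N0).
    exists (ball x (d / 2), ball y (d / 2)).
      by split; apply: nbhsx_ballx; rewrite divr_gt0.
    move=> [x' y'] /= [xx yy]; rewrite distrC -raddfB /= -mulrBr.
    apply: le_trans (normc_ge _).1 _; rewrite Normc.normcM lamN mulrC -ler_pdivlMr //.
    have -> : (x' +i* y' : C) = (x +i* y : C) + ((x' - x) +i* (y' - y) : C).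
      by apply/eqP; rewrite eq_complex /= !subrKC !eqxx.
    apply: Hd; apply: le_lt_trans (normc_le _) _ => /=.
    by move: xx yy; rewrite /ball /= ![`|_ - x'|]distrC ![`|_ - y'|]distrC; lra.
  apply: cvgMl_tmp; apply: cvgD.
    by apply: (continuous_comp (g := fun t : R => t ^+ 2)); [exact: cvg_fst|exact: exprn_continuous].
  by apply: (continuous_comp (g := fun t : R => t ^+ 2)); [exact: cvg_snd|exact: exprn_continuous].
have [||c cQ cmax] := compact_EVT_max (A := Q) _ _ cphi.
- by exists (0, 0); apply/QP; split; rewrite /= normr0.
- by apply: compact_setX; exact: segment_compact.
case: c cQ cmax => a b; rewrite inE => /QP /= abQ cmax.
have phiz1 : N ^+ 2 <= phi (a, b).
  apply: le_trans (cmax (complex.Re z1, complex.Im z1) _); last first.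
    by rewrite inE; apply/QP => /=; case: (z1) z1Q.
  rewrite /phi /= -psi1; have -> : (complex.Re z1 +i* complex.Im z1 : C) = z1 by case: (z1).
  by rewrite lerDl mulr_ge0 ?(ltW eps0) // addr_ge0 ?sqr_ge0.
have sq1 (t : R) : `|t| <= 1 -> t ^+ 2 <= 1.
  by move=> t1; rewrite -real_normK ?num_real // expr_le1.
have eps4 : N ^+ 2 = N * m + 4 * eps by rewrite /eps; field.
have phi_small : psi (a +i* b) <= N * m -> False.
  move=> pm; move: phiz1; rewrite /phi /=.
  by have := sq1 _ abQ.1; have := sq1 _ abQ.2; rewrite /=; nra.
have inner : `|a| < 1 /\ `|b| < 1.
  rewrite !lt_neqAle !abQ.1 !abQ.2 !andbT; apply/andP; rewrite -negb_or; apply/negP => H.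
  apply: phi_small; apply: le_trans (psi_le _) _; rewrite ler_pM2l //; apply: Gm.
  by split => //; case/orP: H => /eqP ?; [left|right].
have notp : ~~ (((a +i* b : C) == p1) || ((a +i* b : C) == p2)).
  apply/negP => H; apply: phi_small; rewrite /psi (G0 _ abQ H).1 mulr0 /=.
  by rewrite mulr_ge0 // ltW.
move: notp; rewrite negb_or => /andP[np1 np2].
have dist_gt0 p : (a +i* b : C) != p -> 0 < nc (p - (a +i* b)).
  move=> H; rewrite lt_neqAle ncge0 andbT eq_sym; apply: contra_neq H => /Normc.eq0_normc /subr0_eq.
  by move=> ->.
have d10 := dist_gt0 _ np1; have d20 := dist_gt0 _ np2.
set d1 := nc (p1 - _) in d10; set d2 := nc (p2 - _) in d20.
pose rho := Num.min (Num.min ((1 - `|a|)) ((1 - `|b|))) (Num.min (d1 / 2) (d2 / 2)).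
have rho0 : 0 < rho by rewrite !lt_min !subr_gt0 inner.1 inner.2 !divr_gt0.
have rhoa : rho <= 1 - `|a| by rewrite !ge_min lexx.
have rhob : rho <= 1 - `|b| by rewrite !ge_min lexx !orbT.
have rho1 : rho <= d1 / 2 by rewrite !ge_min lexx !orbT.
have rho2 : rho <= d2 / 2 by rewrite !ge_min lexx !orbT.
(* For [c = a + i b] one has [|z|^2 = |z - c|^2 + 2 Re (conj c * z) - |c|^2]. The middle term is the
   real part of a holomorphic function; adding it to [lam * G] turns the maximum of [phi] at [c]
   into one of [Re H] with the drop [eps |z - c|^2]. *)
pose H z := lam * G z + (2 * eps)%:C * (a -i* b) * z.
apply: (@no_strict_local_max R H a b rho eps rho0 eps0) => x y xy.
have ncxy : nc (x +i* y) <= rho.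
  by rewrite /= -(ler_pXn2r (n := 2)) ?nnegrE ?sqrtr_ge0 ?(ltW rho0) // sqr_sqrtr // addr_ge0 ?sqr_ge0.
have xr : `|x| <= rho by apply: le_trans ncxy; exact: (normc_ge (x +i* y)).1.
have yr : `|y| <= rho by apply: le_trans ncxy; exact: (normc_ge (x +i* y)).2.
have xyE : ((a + x) +i* (b + y) : C) = (a +i* b : C) + (x +i* y : C) by [].
have xyQ : square ((a + x) +i* (b + y)).
  by split => /=; rewrite (le_trans (ler_normD _ _)) //; lra.
split.
  apply: differentiableD.
    apply: differentiableM; first exact: differentiable_cst.
    apply: dG => //; apply/eqP => E.
      have E1 : d1 = nc (x +i* y) by rewrite /d1 -E xyE addrAC subrr add0r.
      by have := ncxy; rewrite -E1 => ?; lra.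
    have E1 : d2 = nc (x +i* y) by rewrite /d2 -E xyE addrAC subrr add0r.
    by have := ncxy; rewrite -E1 => ?; lra.
  by apply: differentiableM; [exact: differentiable_cst|exact: ex_diff].
have := cmax (a + x, b + y); rewrite inE => /(_ ((QP (a + x, b + y)).2 xyQ)).
rewrite /H /phi /psi /=.
move: (lam * _) => [? ?] /=; move: (lam * _) => [? ?] /=; lra.
Qed.
End MaxPrincipleSquare.

(** * Derivatives of holomorphic functions *)

Section Schwarz.
Import ComplexField.
Local Open Scope complex_scope.
Context {R : realType}.
Local Notation C := (scalar_field R Complexes).
Local Notation nc := (@Normc.normc R).
Implicit Types (z w p : C) (F G : C -> C).

Lemma normc_ge0 z : 0 <= nc z.
Proof. by case: z => ? ?; exact: sqrtr_ge0. Qed.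

Lemma normc_gt0 z : (0 < nc z) = (z != 0).
Proof.
rewrite lt_neqAle normc_ge0 andbT eq_sym; apply/idP/idP.
  by apply: contra_neq => ->; rewrite Normc.normc0.
by apply: contra_neq => /Normc.eq0_normc.
Qed.

Lemma normcX z k : nc (z ^+ k) = nc z ^+ k.
Proof. by elim: k => [|k IH]; rewrite ?expr0 ?Normc.normc1 // !exprS Normc.normcM IH. Qed.

Lemma square_normc_le z : square z -> nc z <= 2.
Proof. by move=> [a b]; rewrite (le_trans (normc_le _)) //; lra. Qed.

(** Half the size, so that division by [z - p] costs at most a factor 2 on the boundary of
    [square]. *)
Definition inner_square : set C :=
  [set z | `|complex.Re z| <= 1 / 2 /\ `|complex.Im z| <= 1 / 2].

Lemma square_boundary_dist z p : square_boundary z -> inner_square p -> 1 / 2 <= nc (z - p).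
Proof.
move=> [_ H] [p1 p2]; have [a b] := normc_ge (z - p).
case: H => H; [apply: le_trans a|apply: le_trans b]; rewrite raddfB /=;
  by rewrite (le_trans _ (lerB_dist _ _)) // H; lra.
Qed.

Lemma inner_square0 : inner_square 0.
Proof. by split; rewrite /= normr0; lra. Qed.

Lemma inner_square_sub p : inner_square p -> square p.
Proof. by move=> [a b]; split; lra. Qed.

Lemma inner_square_add p h : inner_square p -> nc h <= 1 / 2 -> square (p + h).
Proof.
have [] := normc_ge h; case: p => p1 p2; case: h => h1 h2; move: (nc _) => n /=.
move=> A B [/= C1 C2] n2; split; rewrite /= (le_trans (ler_normD _ _)) //; lra.
Qed.

(** [F ^+ k * (z - p1) * (z - p2)] extends continuously by 0 at the exceptional
    points, so that [max_principle_continuous] applies; then let [k] grow. *)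
Lemma max_principle_exceptional F p1 p2 (M B : R) :
  inner_square p1 -> inner_square p2 ->
  (forall z, square z -> z != p1 -> z != p2 -> differentiable F z /\ nc (F z) <= B) ->
  (forall z, square_boundary z -> nc (F z) <= M) ->
  forall z, square z -> z != p1 -> z != p2 -> nc (F z) <= M.
Proof.
move=> p1Q p2Q dF FM z zQ zp1 zp2.
rewrite leNgt; apply/negP => MF.
have M0 : 0 <= M.
  apply: le_trans (normc_ge0 _) (FM 1 _); split; last by left => /=; rewrite normr1.
  by split; rewrite /= ?normr1 ?normr0.
have B0 : 0 <= B by apply: le_trans (normc_ge0 _) (dF z zQ zp1 zp2).2.
pose c := nc (z - p1) * nc (z - p2).
have c0 : 0 < c by rewrite mulr_gt0 // normc_gt0 subr_eq0.
have d4 z' p : square z' -> inner_square p -> nc (z' - p) <= 4.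
  move=> /square_normc_le A /inner_square_sub/square_normc_le A'.
  by rewrite (le_trans (le_normcD _ _)) // normcN; lra.
(* Each of the two linear factors is at most 4 on the square, whence 16, independently of [k]. If
   [nc (F z)] exceeded [M], the powers of their quotient would be bounded, against Bernoulli's
   inequality. *)
have key k : nc (F z) ^+ k * c <= 16 * M ^+ k.
  pose G z := F z ^+ k * ((z - p1) * (z - p2)).
  have GE z' : nc (G z') = nc (F z') ^+ k * (nc (z' - p1) * nc (z' - p2)).
    by rewrite /G !Normc.normcM normcX.
  rewrite -GE; apply: (@max_principle_continuous R G p1 p2) => //.
  - move=> z' z'Q n1 n2; rewrite /G.
    apply: differentiableM.
      by elim: k {G GE} => [|j IH]; [exact: differentiable_cst|
        under eq_fun do rewrite exprS; apply: differentiableM IH; exact: (dF z' z'Q n1 n2).1].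
    apply: differentiableM; apply: differentiableB; first [exact: ex_diff | exact: differentiable_cst].
  - move=> p pQ pp.
    have Gp : G p = 0.
      by rewrite /G; case/orP: pp => /eqP ->; rewrite subrr ?mul0r ?mulr0.
    have pI : inner_square p by case/orP: pp => /eqP ->.
    have Gle z' : square z' -> nc (G z') <= B ^+ k * (4 * nc (z' - p)).
      move=> z'Q; rewrite GE.
      have [E|/norP[n1 n2]] := boolP ((z' == p1) || (z' == p2)).
        rewrite (_ : nc (z' - p1) * nc (z' - p2) = 0) ?mulr0.
          by rewrite mulr_ge0 ?exprn_ge0 ?mulr_ge0 ?normc_ge0.
        by case/orP: E => /eqP ->; rewrite subrr Normc.normc0 ?mul0r ?mulr0.
      apply: ler_pM; rewrite ?exprn_ge0 ?mulr_ge0 ?normc_ge0 //.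
        by apply: lerXn2r; rewrite ?nnegrE ?normc_ge0 //; exact: (dF z' z'Q n1 n2).2.
      have ? := normc_ge0 (z' - p1); have ? := normc_ge0 (z' - p2).
      by case/orP: pp => /eqP ->; [rewrite mulrC|]; rewrite ler_wpM2r // d4.
    split=> //; apply/continuousCP => e e0; rewrite Gp.
    have Bk : 0 < 4 * B ^+ k + 1 by rewrite ltr_wpDl // mulr_ge0 // exprn_ge0.
    exists (Num.min (1 / 2) (e / (4 * B ^+ k + 1))); first by rewrite lt_min !divr_gt0.
    move=> h; rewrite lt_min => /andP[h1]; rewrite ltr_pdivlMr // => h2; rewrite subr0.
    apply: (le_trans (Gle _ _)).
      exact: inner_square_add (ltW h1).
    rewrite addrAC subrr add0r; have := normc_ge0 h; nra.
  - move=> z' z'Q; rewrite GE mulrC.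
    have ? := normc_ge0 (z' - p1); have ? := normc_ge0 (z' - p2).
    apply: ler_pM; rewrite ?mulr_ge0 ?exprn_ge0 ?normc_ge0 //.
      have := d4 _ _ z'Q.1 p1Q; have := d4 _ _ z'Q.1 p2Q; nra.
    by apply: lerXn2r; rewrite ?nnegrE ?normc_ge0 // FM.
(* The quotient by [M] needs [M != 0]; otherwise [k = 1] already gives the contradiction. *)
have [M_eq0|M_neq0] := eqVneq M 0.
  by have := key 1%N; rewrite M_eq0 !expr1 mulr0 leNgt mulr_gt0 // -M_eq0.
have Mp : 0 < M by rewrite lt_neqAle eq_sym M_neq0.
pose d := nc (F z) / M - 1.
have d0 : 0 < d by rewrite subr_gt0 ltr_pdivlMr // mul1r.
have bern k : 1 + d *+ k <= (nc (F z) / M) ^+ k.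
  elim: k => [|k IH]; first by rewrite mulr0n addr0 expr0.
  have FE : nc (F z) / M = 1 + d by rewrite /d subrKC.
  rewrite FE in IH *.
  rewrite exprSr mulrSr; have : 0 <= d *+ k by rewrite mulrn_wge0 // ltW.
  by move: (d *+ k) ((1 + d) ^+ k) IH => t s; nra.
have K2 k : (d *+ k) * c <= 16.
  have := key k; rewrite -(ler_pM2r (x := (M ^+ k)^-1)) ?invr_gt0 ?exprn_gt0 //.
  rewrite mulfK ?expf_neq0 // mulrAC -expr_div_n; apply: le_trans.
  by rewrite ler_wpM2r ?(ltW c0) // (le_trans _ (bern k)) // lerDr.
have P : 0 <= 16 / (d * c) by rewrite ltW // divr_gt0 // (mulr_gt0 d0 c0).
have := archi_boundP P; rewrite ltr_pdivrMr ?(mulr_gt0 d0 c0) //; set k := Num.bound _.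
by apply/negP; rewrite -leNgt mulr_natl -mulrnAl; apply: K2.
Qed.

(** Supplies the rough bound [B] of [max_principle_exceptional], whose size drops out of the
    conclusion there. Near [p] differentiability bounds the quotient; at distance [d] or more the
    bound on [F] does. *)
Lemma difference_quotient_bounded F p (B : R) (Q : set C) : 0 <= B ->
  (forall z, Q z -> nc (F z) <= B) -> differentiable F p ->
  exists2 B' : R, 0 <= B' & forall z, Q z -> nc (F z - F p) <= B' * nc (z - p).
Proof.
move=> B0 FB dF; have [d d0 Hd] := differentiableCP dF ltr01.
pose l := nc ('d F p 1).
exists (l + 1 + (B + nc (F p)) / d).
  by rewrite !addr_ge0 ?normc_ge0 // divr_ge0 ?addr_ge0 ?normc_ge0 // ltW.
move=> z Qz; have K0 : 0 <= (B + nc (F p)) / d.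
  by rewrite divr_ge0 ?addr_ge0 ?normc_ge0 // ltW.
have [zd|zd] := ltP (nc (z - p)) d.
  have := Hd _ zd; rewrite subrKC => H.
  have -> : F z - F p = (F z - F p - (z - p) * 'd F p 1) + (z - p) * 'd F p 1 by rewrite subrK.
  rewrite (le_trans (le_normcD _ _)) // Normc.normcM -/l.
  have ? := normc_ge0 (z - p); have ? : 0 <= l by exact: normc_ge0.
  have := mulr_ge0 K0 (normc_ge0 (z - p)).
  by move: H; set A := nc _; set n := nc (z - p) in A *; set k := _ / d; nra.
have : nc (F z - F p) <= B + nc (F p).
  by rewrite (le_trans (le_normcD _ _)) // normcN lerD2r FB.
move=> /le_trans; apply.
have : B + nc (F p) <= (B + nc (F p)) / d * nc (z - p).
  by rewrite mulrAC ler_pdivlMr // ler_wpM2l // addr_ge0 // normc_ge0.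
have n0 := normc_ge0 (z - p); have := mulr_ge0 (normc_ge0 _ : 0 <= l) n0.
by rewrite !mulrDl mul1r; lra.
Qed.

(** Schwarz's lemma applied twice. The quotient [h1] of [F z - F 0] by [z] is at most
    [2 M / (1/2) = 4 M], and that of [h1 z - h1 w] by [z - w] at most [8 M / (1/2) = 16 M]. As [z]
    tends to 0, [h1 z] tends to the derivative [l], and the quantity to be bounded is
    [w * (h1 w - l)]. *)
Lemma second_order_bound F (M : R) :
  (forall z, square z -> differentiable F z /\ nc (F z) <= M) ->
  forall w, inner_square w ->
    nc (F w - F 0 - w * 'd F 0 1) <= 16 * M * nc w ^+ 2.
Proof.
move=> FM w wQ.
have sq0 : square (0 : C) by split; rewrite /= normr0.
have M0 := le_trans (normc_ge0 (F 0)) (FM 0 sq0).2.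
have [->|w0] := eqVneq w 0.
  by rewrite subrr mul0r subr0 Normc.normc0 expr0n mulr0.
pose h1 z := (F z - F 0) / z.
have dh1 z : square z -> z != 0 -> differentiable h1 z.
  move=> zQ z0; apply: differentiableM.
    by apply: differentiableB; [exact: (FM z zQ).1|exact: differentiable_cst].
  by apply: differentiableV.
have h1M z : square z -> z != 0 -> nc (h1 z) <= 4 * M.
  move=> zQ z0.
  have [B' B0 HB] := difference_quotient_bounded M0 (fun z zQ => (FM z zQ).2) (FM 0 sq0).1.
  apply: (max_principle_exceptional (p1 := 0) (p2 := 0) (B := B') inner_square0 inner_square0) => //.
    move=> z' z'Q z'0 _; split; first exact: dh1.
    rewrite /h1 Normc.normcM Normc.normcV ler_pdivrMr ?normc_gt0 //.
    by have := HB z' z'Q; rewrite subr0.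
  move=> z' z'B.
  have := square_boundary_dist z'B inner_square0; rewrite subr0 => z'1.
  have z'0 : 0 < nc z' by apply: lt_le_trans z'1; rewrite divr_gt0.
  rewrite /h1 Normc.normcM Normc.normcV ler_pdivrMr //.
  rewrite (le_trans (le_normcD _ _)) // normcN.
  by have := (FM z' z'B.1).2; have := (FM 0 sq0).2; nra.
have wS := inner_square_sub wQ.
have h2M z : square z -> z != 0 -> z != w -> nc (h1 z - h1 w) <= 16 * M * nc (z - w).
  move=> zQ z0 zw.
  have [B' B0 HB] := @difference_quotient_bounded h1 w (4 * M) (square `\ 0)
     (mulr_ge0 (ler0n _ 4) M0) (fun z zQ => h1M z zQ.1 (introN eqP zQ.2)) (dh1 w wS w0).
  rewrite -ler_pdivrMr ?normc_gt0 ?subr_eq0 // -Normc.normcV -Normc.normcM.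
  apply: (max_principle_exceptional (F := fun z => (h1 z - h1 w) / (z - w))
    (p1 := 0) (p2 := w) (B := B') inner_square0 wQ) => //.
    move=> z' z'Q z'0 z'w; split.
      apply: differentiableM.
        by apply: differentiableB; [exact: dh1|exact: differentiable_cst].
      apply: differentiableV; last by rewrite subr_eq0.
      by apply: differentiableB; [exact: ex_diff|exact: differentiable_cst].
    rewrite Normc.normcM Normc.normcV ler_pdivrMr ?normc_gt0 ?subr_eq0 //.
    by apply: HB; split => //; exact/eqP.
  move=> z' z'B.
  have z'1 := square_boundary_dist z'B wQ.
  have z'0 : 0 < nc z'.
    by have := square_boundary_dist z'B inner_square0; rewrite subr0; apply: lt_le_trans; rewrite divr_gt0.
  have z'w : 0 < nc (z' - w) by apply: lt_le_trans z'1; rewrite divr_gt0.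
  rewrite Normc.normcM Normc.normcV ler_pdivrMr //.
  rewrite (le_trans (le_normcD _ _)) // normcN.
  have := h1M z' z'B.1; rewrite -normc_gt0 => /(_ z'0); have := h1M w wS w0; nra.
set l := 'd F 0 1.
have lim : nc (l - h1 w) <= 16 * M * nc w.
  apply/ler_addgt0Pl => e e0.
  have m0 : 0 < 1 + 16 * M by rewrite ltr_wpDr // mulr_ge0.
  pose e1 := e / (1 + 16 * M).
  have e10 : 0 < e1 by rewrite divr_gt0.
  have [d d0 Hd] := differentiableCP (FM 0 sq0).1 e10.
  have w'0 : 0 < nc w by rewrite normc_gt0.
  (* A small real point in place of a limit: [t < d] brings [h1 t] within [e1] of [l], [t < nc w]
     keeps it off [w], [t <= 1 / 2] keeps it in the square, and [t <= e1] makes the total error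
     [e1 * (1 + 16 * M) = e]. *)
  pose t := Num.min (Num.min (d / 2) (nc w / 2)) (Num.min e1 (1 / 2)).
  have t0 : 0 < t by rewrite !lt_min !divr_gt0.
  have td : t < d by apply: (@le_lt_trans _ _ (d / 2)); [rewrite !ge_min lexx|lra].
  have tw : t < nc w by apply: (@le_lt_trans _ _ (nc w / 2)); [rewrite !ge_min lexx orbT|lra].
  have te : t <= e1 by rewrite !ge_min lexx !orbT.
  have t1 : t <= 1 / 2 by rewrite !ge_min lexx !orbT.
  have nt : nc t%:C = t by rewrite /= expr0n addr0 sqrtr_sqr gtr0_norm.
  have tz : (t%:C : C) != 0 by rewrite -normc_gt0 nt.
  have tneqw : (t%:C : C) != w by apply/eqP => E; move: tw; rewrite -E nt ltxx.
  have tQ : square (t%:C) by split; rewrite /= ?normr0 ?(gtr0_norm t0); lra.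
  have := h2M _ tQ tz tneqw.
  have : nc (l - h1 t%:C) <= e1.
    rewrite -(ler_pM2r t0).
    have -> : nc (l - h1 t%:C) * t = nc (F t%:C - F 0 - t%:C * l).
      by rewrite -[t in _ * t]nt -Normc.normcM mulrBl divfK // -normcN opprB mulrC.
    by have := Hd t%:C; rewrite nt add0r => /(_ td).
  have -> : l - h1 w = (l - h1 t%:C) + (h1 t%:C - h1 w) by rewrite addrA subrK.
  move=> A1 A2; apply: (le_trans (le_normcD _ _)); apply: (le_trans (lerD A1 A2)).
  have : nc (t%:C - w) <= t + nc w.
    by apply: (le_trans (le_normcD _ _)); rewrite nt normcN.
  have : e1 * (1 + 16 * M) = e by rewrite divfK // gt_eqF.
  by move: (nc (_ - _)) (nc w) (e1) te => *; nra.
have -> : F w - F 0 - w * l = - (w * (l - h1 w)).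
  by rewrite mulrBr opprB [w * h1 w]mulrC divfK.
rewrite normcN Normc.normcM; have := normc_ge0 w.
by move: (nc w) (nc (_ - _)) lim => *; nra.
Qed.
End Schwarz.

(** * Cauchy estimates on normed modules *)

Section Holomorphic.
Import ComplexField.
Local Open Scope complex_scope.
Context {R : realType}.
Local Notation C := (scalar_field R Complexes).
Local Notation nc := (@Normc.normc R).

Lemma le_of_le_half_powers (x y z : R) :
  (forall k : nat, x <= y + z / 2 ^+ k) -> x <= y.
Proof.
move=> H; have [z0|z0] := leP z 0.
  by apply: (le_trans (H 0%N)); rewrite expr0 divr1; lra.
apply/ler_addgt0Pl => e e0.
have P : 0 <= z / e by rewrite ltW // divr_gt0.
have := archi_boundP P; set k := Num.bound _ => kP.
apply: le_trans (H k) _; rewrite addrC lerD2r ler_pdivrMr ?exprn_gt0 //.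
rewrite -ler_pdivrMl // mulrC; apply: (le_trans (ltW kP)).
by rewrite -natrX ler_nat ltnW // ltn_expl.
Qed.

(** The intervals of radius [B / 2 ^+ k] around [x k] meet pairwise, so the supremum of their left
    ends lies in all of them. *)
Lemma cauchy_limit_real (x : nat -> R) (B : R) :
  (forall m k, `|x m - x k| <= B / 2 ^+ m + B / 2 ^+ k) ->
  exists l, forall k, `|x k - l| <= B / 2 ^+ k.
Proof.
move=> H.
have ub m : ubound (range (fun k => x k - B / 2 ^+ k)) (x m + B / 2 ^+ m).
  by move=> _ [k _ <-]; have := H m k; rewrite ler_norml; lra.
exists (sup (range (fun k => x k - B / 2 ^+ k))) => k.
have A : x k - B / 2 ^+ k <= sup (range (fun k => x k - B / 2 ^+ k)).
  by apply: ub_le_sup; [exists (x 0%N + B / 2 ^+ 0) | exists k].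
have A' : sup (range (fun k => x k - B / 2 ^+ k)) <= x k + B / 2 ^+ k.
  by apply: ge_sup => //; exists (x 0%N - B / 2 ^+ 0), 0%N.
by rewrite ler_norml; lra.
Qed.

Lemma cauchy_limit_complex (c : nat -> C) (B : R) :
  (forall m k, nc (c m - c k) <= B / 2 ^+ m + B / 2 ^+ k) ->
  exists l, forall k, nc (c k - l) <= 2 * B / 2 ^+ k.
Proof.
move=> H.
have [a Ha] := @cauchy_limit_real (fun k => complex.Re (c k)) B
   (fun m k => le_trans (eq_ind _ (fun t => `|t| <= _) (normc_ge (c m - c k)).1 _ (raddfB _ _ _)) (H m k)).
have [b Hb] := @cauchy_limit_real (fun k => complex.Im (c k)) B
   (fun m k => le_trans (eq_ind _ (fun t => `|t| <= _) (normc_ge (c m - c k)).2 _ (raddfB _ _ _)) (H m k)).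
exists (a +i* b) => k; apply: le_trans (normc_le _) _.
have := Ha k; have := Hb k; case: (c k) => u v /=; lra.
Qed.

Context {V : normedModType C}.
Implicit Types (g : V -> C) (a x v w : V).

(** Norms in a normed module over [C] are elements of [C]; this is the same number in the totally
    ordered field [R]. *)
Definition rnorm v : R := complex.Re `|v|.

Lemma rnormE v : `|v| = (rnorm v)%:C.
Proof. by rewrite /rnorm RRe_real // normr_real. Qed.

Lemma rnorm_ge0 v : 0 <= rnorm v.
Proof. by rewrite -lecR -rnormE normr_ge0. Qed.

Lemma rnormD v w : rnorm (v + w) <= rnorm v + rnorm w.
Proof. by rewrite -lecR rmorphD /= -!rnormE ler_normD. Qed.

Lemma rnormZ (c : C) v : rnorm (c *: v) = nc c * rnorm v.
Proof. by apply: complexI; rewrite rmorphM /= -rnormE normrZ rnormE normc_normE. Qed.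

Lemma nbhs_rnormP x (A : set V) :
  nbhs x A <-> exists2 d : R, 0 < d & forall h, rnorm h < d -> A (x + h).
Proof.
split.
  move=> /nbhs_ballP[[d di]]; rewrite /= ltcE /= => /andP[/eqP -> d0] H.
  exists d => // h hd; apply: H.
  by rewrite -ball_normE /= opprD addrA subrr add0r normrN rnormE ltcR.
move=> [d d0 H]; apply/nbhs_ballP; exists (d%:C); first by rewrite /= ltcR.
by move=> y; rewrite -ball_normE /= distrC rnormE ltcR => /H; rewrite subrKC.
Qed.

(** Apply [second_order_bound] on the complex line [x + z *: u], where [u] is [w] rescaled to norm
    [rho]. For [z] in the square [nc z <= 2], so the line stays within [3 * rho] of [a], and [w] is
    reached at [z = rnorm w / rho <= 1 / 2]. *)
Lemma holomorphic_second_order g a (rho M : R) : 0 < rho ->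
  (forall y, rnorm (y - a) < 4 * rho -> differentiable g y /\ nc (g y) <= M) ->
  forall x w, rnorm (x - a) <= rho -> rnorm w <= rho / 2 ->
  nc (g (x + w) - g x - 'd g x w) <= 16 * M / rho ^+ 2 * rnorm w ^+ 2.
Proof.
move=> rho0 gM x w xa wr.
have [->|w0] := eqVneq w 0.
  by rewrite addr0 linear0 subrr subr0 Normc.normc0 /rnorm normr0 expr0n /= mulr0.
have wn0 : 0 < rnorm w by rewrite -ltcR -rnormE normr_gt0.
pose s := rnorm w / rho; have s0 : 0 < s by rewrite divr_gt0.
pose u := (s^-1)%:C *: w.
have sC0 : (s%:C : C) != 0 by rewrite eq_complex /= gt_eqF.
have wu : w = s%:C *: u by rewrite /u scalerA -rmorphM /= divff ?scale1r // gt_eqF.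
have nu : rnorm u = rho.
  rewrite /u rnormZ /= expr0n addr0 sqrtr_sqr gtr0_norm ?invr_gt0 //.
  by rewrite /s invf_div mulfVK // gt_eqF.
pose F (z : C) := g (x + z *: u).
have inb (z : C) : square z -> rnorm (x + z *: u - a) < 4 * rho.
  move=> /square_normc_le z2; rewrite addrAC; apply: le_lt_trans (rnormD _ _) _.
  by rewrite rnormZ nu; nra.
have dline (z : C) : is_diff z (fun t : C => x + t *: u) ( *:%R ^~ u).
  by apply: is_diff_eq; rewrite add0r.
have dF (z : C) : square z -> is_diff z F ('d g (x + z *: u) \o ( *:%R ^~ u)).
  move=> zQ; have dg := differentiableP (gM _ (inb z zQ)).1.
  exact: (@is_diff_comp _ _ _ _ (fun t : C => x + t *: u) _ g _ z).
have FM (z : C) : square z -> differentiable F z /\ nc (F z) <= M.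
  by move=> zQ; split; [case: (dF z zQ) | exact: (gM _ (inb z zQ)).2].
have sQ : inner_square (s%:C).
  by split; rewrite /= ?normr0 ?(gtr0_norm s0) /s ?ler_pdivrMr //; lra.
have := second_order_bound FM sQ.
have -> : 'd F 0 1 = 'd g x u.
  have sq0 : square (0 : C) by split; rewrite /= normr0.
  by have := dF 0 sq0 => d; rewrite diff_val /= scale1r scale0r addr0.
have EL : 'd g x w = s%:C * 'd g x u by rewrite [in LHS]wu linearZ.
rewrite /F -wu scale0r addr0 -EL.
have -> : nc s%:C = s by rewrite /= expr0n addr0 sqrtr_sqr gtr0_norm.
move=> /le_trans; apply.
by rewrite le_eqVlt /s; apply/orP; left; apply/eqP; field; rewrite gt_eqF.
Qed.

(** Rescale [w] to norm [rho / 2]: the second-order remainder is then at most [4 * M] and the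
    increment of [g] at most [2 * M], so the differential is at most [6 * M]. *)
Lemma holomorphic_first_order g a (rho M : R) : 0 < rho ->
  (forall y, rnorm (y - a) < 4 * rho -> differentiable g y /\ nc (g y) <= M) ->
  forall x w, rnorm (x - a) <= rho -> nc ('d g x w) <= 12 * M / rho * rnorm w.
Proof.
move=> rho0 gM x w xa.
have [->|w0] := eqVneq w 0.
  by rewrite linear0 Normc.normc0 /rnorm normr0 mulr0.
have wn0 : 0 < rnorm w by rewrite -ltcR -rnormE normr_gt0.
pose s := rho / 2 / rnorm w; have s0 : 0 < s by rewrite !divr_gt0.
have nsw : rnorm (s%:C *: w) = rho / 2.
  by rewrite rnormZ /= expr0n addr0 sqrtr_sqr gtr0_norm // /s divfK // gt_eqF.
have := @holomorphic_second_order g a rho M rho0 gM x (s%:C *: w) xa.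
have EL : 'd g x (s%:C *: w) = s%:C * 'd g x w by rewrite linearZ.
rewrite nsw lexx EL => /(_ isT) H.
have B1 : nc (g x) <= M by apply: (gM x _).2; lra.
have B2 : nc (g (x + s%:C *: w)) <= M.
  by apply: (gM _ _).2; rewrite addrAC (le_lt_trans (rnormD _ _)) // nsw; lra.
have : nc (s%:C * 'd g x w) <= 6 * M.
  have -> : s%:C * 'd g x w = - (g (x + s%:C *: w) - g x - s%:C * 'd g x w) +
     (g (x + s%:C *: w) - g x) by ring.
  apply: le_trans (le_normcD _ _) _; rewrite normcN; apply: (le_trans (lerD H (le_normcD _ _))).
  rewrite normcN (_ : 16 * M / rho ^+ 2 * (rho / 2) ^+ 2 = 4 * M); first lra.
  by field; rewrite gt_eqF.
rewrite Normc.normcM /= expr0n addr0 sqrtr_sqr gtr0_norm // -ler_pdivlMl // => /le_trans; apply.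
by rewrite le_eqVlt /s; apply/orP; left; apply/eqP; field; rewrite !gt_eqF.
Qed.
End Holomorphic.

(** * Differentiability of the derivative *)

Section HolomorphicDerive.
Import ComplexField.
Local Open Scope complex_scope.
Context {R : realType}.
Local Notation C := (scalar_field R Complexes).
Local Notation nc := (@Normc.normc R).
Context {V : normedModType C}.
Implicit Types (g : V -> C) (a x v w : V).

(** [V] may have infinite dimension, so a limit of differentials needs a bound in order to be
    continuous. *)
Lemma bounded_linear_continuous (L : {linear V -> C}) (D : R) :
  (forall w, nc (L w) <= D * rnorm w) -> continuous L.
Proof.
move=> LD x; apply/(@cvgrPdist_le _ _ _ (nbhs x)) => -[e ei].
rewrite ltcE /= => /andP[/eqP -> e0]; apply/nbhs_rnormP.
have D0 : 0 < `|D| + 1 by rewrite ltr_wpDl.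
exists (e / (`|D| + 1)); first by rewrite divr_gt0.
move=> h; rewrite ltr_pdivlMr // => hd.
rewrite linearD opprD addrA subrr add0r normrN normc_normE lecR.
apply: le_trans (LD h) _; have := rnorm_ge0 h; have := ler_norm D; nra.
Qed.

(** The difference quotients [q k] of [g] along [v] converge uniformly near [a],
    and by [holomorphic_second_order] they are differentiable uniformly in [k]. *)
Lemma holomorphic_derive g a v :
  (\forall x \near a, differentiable g x) -> differentiable ('D_v g) a.
Proof.
move=> dg.
have cg := differentiable_continuous (nbhs_singleton dg).
have ltC : 0 < (1 : C) by [].
move: dg cg => /nbhs_rnormP[d1 d10 Hd] /cvgrPdist_le/(_ _ ltC)/nbhs_rnormP[d2 d20 Hb].
pose M := nc (g a) + 1.
pose rho := Num.min d1 d2 / 4.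
have rho0 : 0 < rho by rewrite divr_gt0 // lt_min d10.
have rho1 : 4 * rho <= d1 by rewrite /rho mulrC divfK // ge_min lexx.
have rho2 : 4 * rho <= d2 by rewrite /rho mulrC divfK // ge_min lexx orbT.
clearbody rho.
have gM y : rnorm (y - a) < 4 * rho -> differentiable g y /\ nc (g y) <= M.
  move=> ya; split; first by have := Hd (y - a) (lt_le_trans ya rho1); rewrite subrKC.
  have := Hb (y - a) (lt_le_trans ya rho2); rewrite subrKC normc_normE -[1]/(1%:C : C) lecR => H.
  have -> : g y = g a - (g a - g y) by ring.
  by apply: le_trans (le_normcD _ _) _; rewrite normcN lerD2l.
have ga : rnorm (a - a) < 4 * rho by rewrite subrr /rnorm normr0 /= mulr_gt0.
have M0 : 0 <= M by exact: le_trans (normc_ge0 _) (gM a ga).2.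
pose A := 16 * M / rho ^+ 2 * rnorm v ^+ 2.
have A0 : 0 <= A by rewrite !mulr_ge0 ?invr_ge0 ?exprn_ge0 ?rnorm_ge0 // ltW.
have v0 := rnorm_ge0 v.
have v1 : 0 < rnorm v + 1 by rewrite ltr_wpDl.
(* Steps this short keep the shift along [v] within the radius [rho / 2] of
   [holomorphic_second_order]; the [+ 1] admits [v = 0]. *)
pose t k := rho / 2 / (rnorm v + 1) / 2 ^+ k.
have t0 k : 0 < t k by rewrite /t !divr_gt0 ?exprn_gt0.
have tv k : t k * rnorm v <= rho / 2.
  have : t k <= rho / 2 / (rnorm v + 1).
    rewrite /t ler_pdivrMr ?exprn_gt0 // ler_peMr ?exprn_ege1 ?ler1n //.
    by rewrite ltW // !divr_gt0.
  rewrite ler_pdivlMr // mulrDr mulr1; have := t0 k; lra.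
have nt k : nc (t k)%:C = t k by rewrite /= expr0n addr0 sqrtr_sqr gtr0_norm.
have ntv k : rnorm ((t k)%:C *: v) <= rho / 2 by rewrite rnormZ nt.
have tC k : ((t k)%:C : C) != 0 by rewrite eq_complex /= gt_eqF.
pose q k x : C := ((t k)%:C : C)^-1 * (g (x + (t k)%:C *: v) - g x).
have qD k x : rnorm (x - a) <= rho -> nc (q k x - 'D_v g x) <= A * t k.
  move=> xa; have dgx : differentiable g x by apply: (gM x _).1; lra.
  rewrite deriveE // -(ler_pM2l (t0 k)) -{1}nt -Normc.normcM mulrBr mulrA divff // mul1r.
  have E : (t k)%:C * 'd g x v = 'd g x ((t k)%:C *: v) by rewrite linearZ.
  rewrite E; apply: le_trans (holomorphic_second_order rho0 gM xa (ntv k)) _.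
  by rewrite rnormZ nt /A le_eqVlt; apply/orP; left; apply/eqP; ring.
(* As [4 * sg = rho / 2], both points entering [q k] stay within [rho] of [a], and the estimates
   apply to [q k] itself with radius [sg]. *)
pose sg := rho / 8; have sg0 : 0 < sg by rewrite divr_gt0.
have sgr y : rnorm (y - a) < 4 * sg -> rnorm (y - a) <= rho / 2.
  by rewrite /sg => H; lra.
pose M1 := 12 * M / rho * rnorm v + A * t 0%N.
have tk0 k : t k = t 0%N / 2 ^+ k by rewrite /t expr0 divr1.
have tkle k : t k <= t 0%N.
  by rewrite tk0 ler_pdivrMr ?exprn_gt0 // ler_peMr ?(ltW (t0 _)) // exprn_ege1 // ler1n.
have qdiff k y : rnorm (y - a) < 4 * sg -> differentiable (q k) y.
  move=> /sgr ya.
  have d1' : differentiable g (y + (t k)%:C *: v).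
    apply: (gM _ _).1; rewrite addrAC; apply: le_lt_trans (rnormD _ _) _.
    by have := ntv k; lra.
  have d2' : differentiable g y by apply: (gM _ _).1; lra.
  apply: differentiableM; first exact: differentiable_cst.
  apply: differentiableB => //.
  apply: (@differentiable_comp _ _ _ _ (fun x => x + (t k)%:C *: v) g) => //.
have qM k y : rnorm (y - a) < 4 * sg -> differentiable (q k) y /\ nc (q k y) <= M1.
  move=> ya; split; first exact: qdiff.
  have /sgr ya2 := ya; have ya3 : rnorm (y - a) <= rho by lra.
  have -> : q k y = (q k y - 'D_v g y) + 'D_v g y by rewrite subrK.
  apply: le_trans (le_normcD _ _) _; rewrite addrC lerD //.
    rewrite deriveE; first exact: holomorphic_first_order gM _ _ ya3.
    by apply: (gM y _).1; lra.
  by apply: le_trans (qD k y ya3) _; rewrite ler_wpM2l.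
have aa : rnorm (a - a) < 4 * sg by rewrite subrr /rnorm normr0 /= mulr_gt0.
have aa' : rnorm (a - a) <= sg by rewrite subrr /rnorm normr0 /= ltW.
pose B w := 12 * (A * t 0%N) / sg * rnorm w.
(* [q m - q k] is holomorphic and uniformly small near [a], so the first-order estimate makes the
   differentials at [a] a Cauchy sequence with geometric rate. *)
have cauchy w m k : nc ('d (q m) a w - 'd (q k) a w) <= B w / 2 ^+ m + B w / 2 ^+ k.
  rewrite -(diff_sub w (qdiff m a aa) (qdiff k a aa)).2.
  have H y : rnorm (y - a) < 4 * sg ->
      differentiable (fun y => q m y - q k y) y /\ nc (q m y - q k y) <= A * t m + A * t k.
    move=> ya; split; first exact: (diff_sub w (qdiff m y ya) (qdiff k y ya)).1.
    have /sgr ya2 := ya; have ya3 : rnorm (y - a) <= rho by lra.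
    have -> : q m y - q k y = (q m y - 'D_v g y) - (q k y - 'D_v g y) by ring.
    by apply: le_trans (le_normcD _ _) _; rewrite normcN lerD // qD.
  apply: le_trans (holomorphic_first_order sg0 H w aa') _.
  rewrite /B (tk0 m) (tk0 k) le_eqVlt; apply/orP; left; apply/eqP; ring.
have [L HL] := choice (fun w => cauchy_limit_complex (cauchy w)).
have nc_eq0 (z : C) (s : R) : (forall k : nat, nc z <= s / 2 ^+ k) -> z = 0.
  move=> H; apply: Normc.eq0_normc; apply/eqP; rewrite eq_le normc_ge0 andbT.
  by apply: (@le_of_le_half_powers _ _ _ s) => k; rewrite add0r.
have L_lin : linear L.
  move=> c w w'; apply/eqP; rewrite -subr_eq0; apply/eqP.
  apply: (nc_eq0 _ (2 * B (c *: w + w') + nc c * (2 * B w) + 2 * B w')) => k.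
  have -> : L (c *: w + w') - (c *: L w + L w') =
     - ('d (q k) a (c *: w + w') - L (c *: w + w')) +
     c * ('d (q k) a w - L w) + ('d (q k) a w' - L w').
    have -> : 'd (q k) a (c *: w + w') = c * 'd (q k) a w + 'd (q k) a w' by rewrite linearP.
    rewrite -[c *: L w]/(c * L w).
    by move: (L (_ + _)) (L w) (L w') ('d (q k) a w) ('d (q k) a w') => *; ring.
  apply: le_trans (le_normcD _ _) _; apply: le_trans (lerD (le_normcD _ _) (lexx _)) _.
  rewrite normcN Normc.normcM.
  have h1 := HL (c *: w + w') k; have h2 := ler_wpM2l (normc_ge0 c) (HL w k).
  by have h3 := HL w' k; lra.
pose Lm := GRing.isLinear.Build C V C *:%R L L_lin.
pose LL : {linear V -> C} := HB.pack L Lm.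
have cL : continuous LL.
  apply: (@bounded_linear_continuous LL (12 * M1 / sg + 2 * (12 * (A * t 0%N) / sg))) => w.
  have -> : LL w = 'd (q 0%N) a w - ('d (q 0%N) a w - L w) by rewrite /=; ring.
  apply: le_trans (le_normcD _ _) _; rewrite normcN mulrDl lerD //.
    exact: holomorphic_first_order (qM 0%N) _ _ aa'.
  by have := HL w 0%N; rewrite expr0 divr1 /B; lra.
suff : is_diff a ('D_v g) LL by case.
apply: near_differentiable => // -[e ei]; rewrite ltcE /= => /andP[/eqP -> e0].
pose D := 16 * M1 / sg ^+ 2.
have D0 : 0 < `|D| + 1 by rewrite ltr_wpDl.
apply/nbhs_rnormP; exists (Num.min (sg / 2) (e / (`|D| + 1))).
  by rewrite lt_min !divr_gt0.
move=> w; rewrite lt_min add0r => /andP[w1]; rewrite ltr_pdivlMr // => w2.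
rewrite normc_normE rnormE -[e +i* 0]/(e%:C) -rmorphM lecR.
apply: (@le_trans _ _ (D * rnorm w ^+ 2)); last first.
  have := rnorm_ge0 w; have := ler_norm D; rewrite expr2 mulrA => Dn wn.
  by rewrite ler_wpM2r //; nra.
(* For fixed [w] let [k] tend to infinity: only the remainder [D * rnorm w ^+ 2], the same for all
   [k], survives. *)
apply: (@le_of_le_half_powers _ _ _ (A * t 0%N + A * t 0%N + 2 * B w)) => k.
have waw : rnorm (a + w - a) <= rho by rewrite addrAC subrr add0r; rewrite /sg in w1; lra.
have arho : rnorm (a - a) <= rho by rewrite subrr /rnorm normr0 /= ltW.
have -> : 'D_v g (a + w) - 'D_v g a - LL w =
  (q k (a + w) - q k a - 'd (q k) a w) + ('d (q k) a w - L w) +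
  (- (q k (a + w) - 'D_v g (a + w)) + (q k a - 'D_v g a)).
  by rewrite /=; move: (q k _) (q k _) ('D_v g _) ('D_v g _) ('d _ _ _) (L w) => *; ring.
have H1 := holomorphic_second_order sg0 (qM k) aa' (ltW w1).
have H2 := HL w k.
have H3 := qD k (a + w) waw.
have H4 := qD k a arho.
apply: le_trans (le_normcD _ _) _; apply: le_trans (lerD (le_normcD _ _) (le_normcD _ _)) _.
have -> : D * rnorm w ^+ 2 + (A * t 0%N + A * t 0%N + 2 * B w) / 2 ^+ k =
  D * rnorm w ^+ 2 + 2 * B w / 2 ^+ k + (A * t k + A * t k) by rewrite (tk0 k); ring.
by rewrite normcN; exact: (lerD (lerD H1 H2) (lerD H3 H4)).
Qed.
End HolomorphicDerive.

(** * Hadamard's lemma *)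

Definition continuous_on (K : numFieldType) (E : set K) (phi : K -> K) :=
  forall s, E s -> {for s, continuous phi}.

(** The properties of the integral over the segment [0, 1] of [K], real or
    complex, on which Hadamard's lemma depends. *)
Definition segment_integral (K : numFieldType) (E : set K) (I : (K -> K) -> K) :=
  [/\ compact E, forall s, E s -> `|s| <= 1,
      forall phi psi c, continuous_on E phi -> continuous_on E psi ->
        I (fun s => phi s + c * psi s) = I phi + c * I psi,
      forall phi B, continuous_on E phi -> (forall s, E s -> `|phi s| <= B) ->
        `|I phi| <= 2 * B
    & forall psi dpsi, (forall s, E s -> is_derive s 1 psi (dpsi s)) ->
        continuous_on E dpsi -> I dpsi = psi 1 - psi 0].

Section Hadamard.
Context {K : numFieldType} {E : set K} {I : (K -> K) -> K}.
Hypothesis EI : segment_integral E I.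

Let cE : compact E. Proof. by case: EI. Qed.
Let E1 s : E s -> `|s| <= 1. Proof. by case: EI => _ + _ _ _; apply. Qed.
Let IL phi psi c : continuous_on E phi -> continuous_on E psi ->
   I (fun s => phi s + c * psi s) = I phi + c * I psi.
Proof. by case: EI => _ _ + _ _; apply. Qed.
Let Ib phi B : continuous_on E phi -> (forall s, E s -> `|phi s| <= B) ->
   `|I phi| <= 2 * B.
Proof. by case: EI => _ _ _ + _; apply. Qed.
Let FTC psi dpsi : (forall s, E s -> is_derive s 1 psi (dpsi s)) ->
        continuous_on E dpsi -> I dpsi = psi 1 - psi 0.
Proof. by case: EI => _ _ _ _; apply. Qed.

Lemma continuous_on_cst c : continuous_on E (fun=> c).
Proof. by move=> s _; exact: cst_continuous. Qed.

Lemma continuous_on_lin phi psi c : continuous_on E phi -> continuous_on E psi ->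
  continuous_on E (fun s => phi s + c * psi s).
Proof.
move=> cphi cpsi s Es; apply: (@cvgD _ _ _ (nbhs s)); first exact: cphi.
by apply: (@cvgMl_tmp _ _ (nbhs s)); exact: cpsi.
Qed.

(** The difference has integral 0 by linearity and the norm bound with [B = 0]. *)
Lemma segment_integral_ext phi psi : continuous_on E phi -> continuous_on E psi ->
  (forall s, E s -> phi s = psi s) -> I phi = I psi.
Proof.
move=> cphi cpsi eq; have := @Ib (fun s => phi s + (-1) * psi s) 0
  (continuous_on_lin (c := -1) cphi cpsi).
rewrite IL // mulr0 normr_le0 mulN1r subr_eq0 => H; apply/eqP/H => s Es.
by rewrite eq // mulN1r subrr normr0 lexx.
Qed.

Lemma segment_integral_cst c : I (fun=> c) = c.
Proof.
have cst s : E s -> is_derive s 1 (fun t : K => c * t) c.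
  move=> _; have := @is_deriveZ _ _ _ id c s 1 1 (is_derive_id s 1).
  by rewrite [_ *: _]mulr1.
have := @FTC (fun t => c * t) (fun=> c) cst (continuous_on_cst (c := c)).
by rewrite mulr1 mulr0 subr0.
Qed.

Context {n : nat}.
Local Notation V := 'rV[K]_n.
Implicit Types (a x y v w : V) (phi g : V -> K).

Lemma continuous_line y w (s : K) : {for s, continuous (fun t : K => y + t *: w)}.
Proof.
have [] : is_diff s (fun t : K => y + t *: w) ( *:%R ^~ w).
  by apply: is_diff_eq; rewrite add0r.
by move=> /differentiable_continuous.
Qed.

Lemma is_derive_line phi y w (s : K) : differentiable phi (y + s *: w) ->
  is_derive s 1 (fun t : K => phi (y + t *: w)) ('D_w phi (y + s *: w)).
Proof.
move=> dphi.
have dline : is_diff s (fun t : K => y + t *: w) ( *:%R ^~ w).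
  by apply: is_diff_eq; rewrite add0r.
have D := @is_diff_comp _ _ _ _ (fun t : K => y + t *: w) _ phi _ s dline
   (differentiableP dphi).
have d : differentiable (phi \o (fun t : K => y + t *: w)) s by case: D.
split; first exact: diff_derivable.
by rewrite deriveE // diff_val /= scale1r deriveE.
Qed.

Lemma rV_linear_continuous (L : {linear V -> K}) : continuous L.
Proof.
have -> : (L : V -> K) = fun v => \sum_(j < n) v 0 j * L (delta_mx 0 j).
  apply/funext => v; rewrite {1}[v]row_sum_delta linear_sum; apply: eq_bigr => j _.
  by rewrite linearZ.
have C0 : Ck 0 [set: V] (fun v => \sum_(j < n) v 0 j * L (delta_mx 0 j)).
  apply: Ck_sum; first exact: openT.
  move=> j; apply: (@CkM _ _ _ 0); [exact: openT| |exact: Ck_cst].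
  by move=> v _; exact: coord_continuous.
by move=> v; exact: C0.
Qed.

Lemma norm_coord_le v j : `|v 0 j| <= `|v|.
Proof.
rewrite [leRHS]/Num.Def.normr/= mx_normE.
have : `|v 0 j|%:nng <= \big[Order.max/0%:nng]_i `|v i.1 i.2|%:nng.
  exact: (le_bigmax _ (fun i => `|v i.1 i.2|%:nng) (0, j)).
by rewrite -num_le.
Qed.

(** The estimate is uniform in the base point [y], as the compactness argument for differentiation
    under the integral demands. The increment is the integral of ['D_w phi] along the segment, and
    the partial derivatives vary little near [y0]. *)
Lemma strict_differentiable (O : set V) phi y0 (e : K) : open O -> O y0 ->
  Ck 2 O phi -> 0 < e ->
  \forall y \near y0 & w \near (0 : V),
    `|phi (y + w) - phi y - 'D_w phi y| <= e * `|w|.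
Proof.
move=> oO Oy0 [dphi Dphi] e0.
(* A factor 2 comes from the integral bound, another from comparing two points with [y0], and [n]
   from the partial derivatives; the [+ 1] admits [n = 0]. *)
have N0 : 0 < 4 * n%:R + 1 :> K by rewrite ltr_wpDl // mulr_ge0.
pose e' := e / (4 * n%:R + 1); have e'0 : 0 < e' by rewrite divr_gt0.
have : \forall y \near y0, O y /\
    forall j, `|'D_(delta_mx 0 j) phi y0 - 'D_(delta_mx 0 j) phi y| <= e'.
  near=> y; split; first by near: y; exact: open_nbhs_nbhs.
  near: y; apply: filter_forall => j.
  have : {for y0, continuous ('D_(delta_mx 0 j) phi)}.
    by apply: differentiable_continuous; exact: (Dphi _).1.
  by move=> /cvgrPdist_le; exact.
move=> /nbhs_ballP[d /= d0 Hd].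
exists (ball y0 (d / 2), ball 0 (d / 2)).
  by split; apply: nbhsx_ballx; rewrite divr_gt0.
move=> [y w] /= [].
rewrite -!ball_normE /= sub0r normrN => yd wd.
have inb s : E s -> ball y0 d (y + s *: w).
  move=> /E1 s1; rewrite -ball_normE /= opprD addrA (splitr d).
  apply: le_lt_trans (ler_normB _ _) _; apply: ltrD => //.
  by rewrite normrZ; apply: le_lt_trans wd; rewrite ler_piMl.
have Oy : O y by apply: (Hd y _).1; rewrite -ball_normE /= (lt_trans yd) // ltr_pdivrMr // ltr_pMr // ltr1n.
have dline s : E s -> is_derive s 1 (fun t : K => phi (y + t *: w)) ('D_w phi (y + s *: w)).
  by move=> Es; apply/is_derive_line/dphi; exact: (Hd _ (inb s Es)).1.
have cline s : {for s, continuous (fun t : K => y + t *: w)}.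
  exact: continuous_line.
have cD : continuous_on E (fun s => 'D_w phi (y + s *: w)).
  move=> s Es; apply: (@continuous_comp _ _ _ (fun t : K => y + t *: w) ('D_w phi)) => //.
  by apply: differentiable_continuous; apply: (Dphi w).1; exact: (Hd _ (inb s Es)).1.
have := FTC dline cD; rewrite scale1r scale0r addr0 => <-.
have -> : I (fun s => 'D_w phi (y + s *: w)) - 'D_w phi y =
   I (fun s => 'D_w phi (y + s *: w) + (-1) * (fun=> 'D_w phi y) s).
  have cc := @continuous_on_cst ('D_w phi y).
  by rewrite (IL _ cD cc) segment_integral_cst mulN1r.
apply: le_trans (_ : 2 * (n%:R * (2 * e' * `|w|)) <= _).
  have cc := @continuous_on_cst ('D_w phi y).
  apply: (Ib (continuous_on_lin (c := -1) cD cc)) => s Es; rewrite mulN1r.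
  have dy : differentiable phi y by exact: dphi.
  have ds : differentiable phi (y + s *: w) by apply: dphi; exact: (Hd _ (inb s Es)).1.
  have D z : differentiable phi z ->
      'D_w phi z = \sum_(j < n) w 0 j * 'D_(delta_mx 0 j) phi z.
    by move=> dz; rewrite deriveE // diff_row_sum.
  rewrite (D _ ds) (D _ dy) -sumrB.
  have -> : n%:R * (2 * e' * `|w|) = \sum_(j < n) (2 * e' * `|w|).
    by rewrite sumr_const card_ord mulr_natl.
  apply: le_trans (ler_norm_sum _ _ _) _; apply: ler_sum => j _.
  rewrite -mulrBr normrM mulrC; apply: ler_pM => //; last exact: norm_coord_le.
  have -> : 2 * e' = e' + e' by rewrite mulr_natl.
  set A := 'D__ _ (y + _); set B := 'D__ _ y; set C := 'D_(delta_mx 0 j) phi y0.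
  have -> : A - B = (C - B) - (C - A) by ring.
  apply: le_trans (ler_normB _ _) _; apply: lerD.
    by apply: (Hd y _).2; rewrite -ball_normE /= (lt_trans yd) // ltr_pdivrMr // ltr_pMr // ltr1n.
  exact: (Hd _ (inb s Es)).2.
have -> : 2 * (n%:R * (2 * e' * `|w|)) = (4 * n%:R * e') * `|w| by ring.
rewrite ler_wpM2r // /e' mulrA ler_pdivrMr // mulrC ler_pM2l //.
by rewrite lerDl.
Unshelve. all: by end_near. Qed.

Lemma continuous_expr m (s : K) : {for s, continuous (fun t : K => t ^+ m)}.
Proof.
elim: m => [|m IH]; first exact: cst_continuous.
rewrite /prop_for /continuous_at exprS; under eq_fun do rewrite exprS.
by apply: (@cvgM _ _ (nbhs s)) => //; exact: cvg_id.
Qed.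

(** The weight [s ^+ m] is what [m] differentiations in [x] produce, which makes this family closed
    under derivatives. *)
Definition segment_average a (m : nat) phi x : K :=
  I (fun s => s ^+ m * phi (a + s *: (x - a))).

Section Average.
Variables (a : V) (rho : K).
Let O := ball a rho.
Let oO : open O. Proof. exact: ball_open. Qed.

Let segO x s : O x -> E s -> O (a + s *: (x - a)).
Proof.
rewrite /O -ball_normE /= => xa /E1 s1.
rewrite opprD addrA subrr add0r normrN normrZ.
by apply: le_lt_trans xa; rewrite -[X in _ <= X]normrN opprB ler_piMl.
Qed.

Let continuous_average m phi x : Ck 0 O phi -> O x ->
  continuous_on E (fun s => s ^+ m * phi (a + s *: (x - a))).
Proof.
move=> cphi Ox s Es; apply: (@cvgM _ _ (nbhs s)); first exact: continuous_expr.
apply: (@continuous_comp _ _ _ (fun t : K => a + t *: (x - a)) phi).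
  exact: continuous_line.
by apply: cphi; exact: segO.
Qed.

Let derive_lin phi x v w (c : K) : Ck 2 O phi -> O x ->
  'D_(c *: v + w) phi x = c * 'D_v phi x + 'D_w phi x.
Proof. by move=> [d _] Ox; rewrite !deriveE ?linearP //; exact: d. Qed.

Let average_derive_linear m phi x : Ck 2 O phi -> O x ->
  linear (fun v => segment_average a m ('D_v phi) x).
Proof.
move=> Cphi Ox c v w; have D v' : Ck 0 O ('D_v' phi) by apply: CkW; exact: Cphi.2.
have cD v' := @continuous_average m _ _ (D v') Ox.
rewrite /segment_average addrC -IL //; apply: segment_integral_ext => //.
- exact: continuous_on_lin.
- by move=> s Es; rewrite (derive_lin _ _ _ Cphi (segO Ox Es)); ring.
Qed.

(** Differentiation under the integral sign: the inner derivative of [a + s *: (x - a)] raises the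
    exponent of [s] by one. *)
Lemma is_diff_segment_average m phi x : Ck 2 O phi -> O x ->
  exists2 L : {linear V -> K}, is_diff x (segment_average a m phi) L &
    forall v, L v = segment_average a m.+1 ('D_v phi) x.
Proof.
move=> Cphi Ox.
pose Lm := GRing.isLinear.Build K V K *:%R _ (average_derive_linear m.+1 Cphi Ox).
pose L : {linear V -> K} := HB.pack (fun v => segment_average a m.+1 ('D_v phi) x) Lm.
have D v' : Ck 0 O ('D_v' phi) by apply: CkW; exact: Cphi.2.
have C0 : Ck 0 O phi by do 2!apply: CkW.
exists L => //; apply: near_differentiable => [|e e0]; first exact: rV_linear_continuous.
have e20 : 0 < e / 2 by rewrite divr_gt0.
pose P (v : V) (s : K) :=
  `|phi (a + s *: (x - a) + s *: v) - phi (a + s *: (x - a)) -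
     'D_(s *: v) phi (a + s *: (x - a))| <= e / 2 * `|v|.
(* Compactness of [E] merges the estimates near each [s0] into a single neighbourhood of 0 for [v];
   [s *: v] is small with [v] because [|s| <= 1] on [E]. *)
have cov : \forall v \near (0 : V), E `<=` P v.
  have /compact_near_coveringP/near_covering_withinP cov := cE.
  have {}cov := cov _ _ P (nbhs_filter (0 : 'rV[K]_n)).
  apply: cov => s0 Es0.
  have [[A B] /= [nA nB] H] := strict_differentiable oO (segO Ox Es0) Cphi e20.
  have nA' : \forall s \near s0, A (a + s *: (x - a)) by exact: continuous_line nA.
  have [d /= d0 Hd] := (nbhs_ballP _ _).1 nB.
  exists ([set s | A (a + s *: (x - a))], ball 0 d); first by split => //; exact: nbhsx_ballx.
  move=> [s v] /= [As vd] Es.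
  have svd : `|s *: v| <= `|v| by rewrite normrZ ler_piMl // E1.
  have Bsv : B (s *: v).
    apply: Hd; move: vd; rewrite -!ball_normE /= !sub0r !normrN; exact: le_lt_trans.
  have := H (_, _) (conj As Bsv) => /le_trans; apply.
  by rewrite /= ler_pM2l.
have nO : \forall v \near (0 : V), O (x + v).
  have /nbhs_ballP[d /= d0 Hd] : nbhs x O by exact: open_nbhs_nbhs.
  apply/nbhs_ballP; exists d => // v; rewrite -ball_normE /= sub0r normrN => vd.
  by apply: Hd; rewrite -ball_normE /= opprD addrA subrr add0r normrN.
near=> v.
have Oxv : O (x + v) by near: v.
have Hv : E `<=` P v by near: v.
have c1 := @continuous_average m _ _ C0 Ox.
have c2 := @continuous_average m _ _ C0 Oxv.
have c3 := @continuous_average m.+1 _ _ (D v) Ox.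
have -> : segment_average a m phi (x + v) - segment_average a m phi x - L v =
  I (fun s => (s ^+ m * phi (a + s *: (x + v - a)) + (-1) * (s ^+ m * phi (a + s *: (x - a)))) +
     (-1) * (s ^+ m.+1 * 'D_v phi (a + s *: (x - a)))).
  rewrite !IL //; last exact: continuous_on_lin.
  by rewrite !mulN1r.
have -> : e * `|v| = 2 * (e / 2 * `|v|) by field.
apply: Ib; first by apply: continuous_on_lin => //; exact: continuous_on_lin.
move=> s Es.
have -> : a + s *: (x + v - a) = a + s *: (x - a) + s *: v.
  by rewrite -[RHS]addrA -scalerDr [x + v - a]addrAC.
have -> : s ^+ m.+1 * 'D_v phi (a + s *: (x - a)) =
   s ^+ m * 'D_(s *: v) phi (a + s *: (x - a)).
  have dphi : differentiable phi (a + s *: (x - a)) by apply: Cphi.1; exact: segO.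
  by rewrite !deriveE // linearZ exprSr -mulrA.
have := Hv s Es; rewrite /P.
set X := phi (_ + _ *: v); set Y := phi _; set Z := 'D__ _ _ => XYZ.
have -> : s ^+ m * X + -1 * (s ^+ m * Y) + -1 * (s ^+ m * Z) = s ^+ m * (X - Y - Z).
  by ring.
rewrite normrM; apply: le_trans XYZ; rewrite ler_piMl // normrX exprn_ile1 //.
exact: E1.
Unshelve. all: by end_near. Qed.

Lemma Cinfty_segment_average m phi : Cinfty O phi ->
  Cinfty O (segment_average a m phi).
Proof.
move=> Cphi k; elim: k m phi Cphi => [|k IH] m phi Cphi /=.
  move=> x Ox; have [L [d _] _] := is_diff_segment_average m (Cphi 2%N) Ox.
  exact: differentiable_continuous.
split=> [x Ox|v]; first by have [L [d _] _] := is_diff_segment_average m (Cphi 2%N) Ox.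
apply: (@Ck_eq _ _ _ _ _ (segment_average a m.+1 ('D_v phi))) => //; last first.
  by apply: IH => j; exact: (Cphi j.+1).2.
move=> x Ox; have [L [d E'] LE] := is_diff_segment_average m (Cphi 2%N) Ox.
by rewrite deriveE // E' LE.
Qed.

Lemma hadamard_ball g x : Cinfty O g -> O a -> O x ->
  g x = g a + \sum_(j < n) (x - a) 0 j * segment_average a 0 ('D_(delta_mx 0 j) g) x.
Proof.
move=> Cg Oa Ox.
pose Lm := GRing.isLinear.Build K V K *:%R _ (average_derive_linear 0 (Cg 2%N) Ox).
pose L : {linear V -> K} := HB.pack (fun v => segment_average a 0 ('D_v g) x) Lm.
have -> : \sum_(j < n) (x - a) 0 j * segment_average a 0 ('D_(delta_mx 0 j) g) x = L (x - a).
  rewrite [in RHS](row_sum_delta (x - a)) linear_sum; apply: eq_bigr => j _.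
  by rewrite linearZ.
have D : Ck 0 O ('D_(x - a) g) by exact: (Cg 1%N).2.
have cD : continuous_on E (fun s => 'D_(x - a) g (a + s *: (x - a))).
  have -> : (fun s : K => 'D_(x - a) g (a + s *: (x - a))) =
      fun s => s ^+ 0 * 'D_(x - a) g (a + s *: (x - a)).
    by apply/funext => s; rewrite expr0 mul1r.
  exact: (continuous_average (m := 0) D Ox).
have dg s : E s -> is_derive s 1 (fun t : K => g (a + t *: (x - a)))
    ('D_(x - a) g (a + s *: (x - a))).
  by move=> Es; apply: is_derive_line; apply: (Cg 1%N).1; exact: segO.
have := FTC dg cD; rewrite scale1r scale0r addr0 subrKC => H.
have -> : L (x - a) = I (fun s => 'D_(x - a) g (a + s *: (x - a))).
  by rewrite /= /segment_average; congr I; apply/funext => s; rewrite expr0 mul1r.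
by rewrite H subrKC.
Qed.
End Average.
End Hadamard.

(** * Integration over [0, 1] with real and complex values *)

Section SegmentIntegrals.
Import ComplexField.
Local Open Scope complex_scope.
Context {R : realType}.
Local Notation C := (scalar_field R Complexes).
Local Notation nc := (@Normc.normc R).

Lemma itg_FTC (f F : R -> R) : continuous_on_itv 0 1 f ->
  (forall t : R, 0 <= t <= 1 -> is_derive t 1 F (f t)) -> itg 0 1 f = F 1 - F 0.
Proof.
move=> cf dF.
have cF (t : R) : 0 <= t <= 1 -> {for t, continuous F}.
  by move=> /dF[d _]; apply: differentiable_continuous; exact/derivable1_diffP.
rewrite /itg /Rintegral (@continuous_FTC2 R f F 0 1) //.
- by apply: continuous_in_subspaceT => x; rewrite inE /= in_itv /=; exact: cf.
- split.
  + move=> x; rewrite in_itv /= => /andP[x0 x1].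
    by have [] : is_derive x 1 F (f x) by apply: dF; rewrite !ltW.
  + by apply: cvg_at_right_filter; apply: cF; rewrite lexx ler01.
  + by apply: cvg_at_left_filter; apply: cF; rewrite lexx ler01.
move=> x; rewrite in_itv /= => /andP[x0 x1]; rewrite derive1E.
by have [_ ->] : is_derive x 1 F (f x) by apply: dF; rewrite !ltW.
Qed.

Lemma norm_itg_le (f : R -> R) (B : R) : continuous_on_itv 0 1 f ->
  (forall t, 0 <= t <= 1 -> `|f t| <= B) -> `|itg 0 1 f| <= B.
Proof.
move=> cf fB; have := @itg_near_cst _ 0 1 f 0 B ler01 cf.
by rewrite mul0r !subr0 mulr1; apply => t /fB; rewrite subr0.
Qed.

Lemma segment_integral_real :
  @segment_integral (scalar_field R Reals) [set` `[0, 1]%R] (fun f => itg 0 1 f).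
Proof.
have E (phi : R -> R) : continuous_on [set` `[0, 1]%R] phi -> continuous_on_itv 0 1 phi.
  by move=> cphi t t01; apply: cphi; rewrite /= in_itv.
split.
- exact: segment_compact.
- by move=> s; rewrite /= in_itv /= => /andP[s0 s1]; rewrite ger0_norm.
- move=> phi psi c /E cphi /E cpsi; rewrite itgD // ?itgZ //.
  by move=> t t01; apply: cvgMl_tmp; exact: cpsi.
- move=> phi B /E cphi H; have H' : `|itg 0 1 phi| <= B.
    by apply: norm_itg_le => // t t01; apply: H; rewrite /= in_itv.
  by apply: (le_trans H'); rewrite mulr_natl mulr2n lerDl (le_trans _ H').
- move=> psi dpsi H /E cd; exact: itg_FTC.
Qed.

Lemma is_derive_eps (f : R -> R) (t l : R) :
  (forall e, 0 < e -> exists2 d, 0 < d & forall h, `|h| < d ->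
     `|f (t + h) - f t - h * l| <= e * `|h|) -> is_derive t 1 f l.
Proof.
move=> H.
have lin : linear ( *%R^~ l : R -> R) by move=> a x y; rewrite mulrDl -mulrA.
pose Lm := GRing.isLinear.Build R R R *:%R _ lin.
pose L : {linear R -> R} := HB.pack (fun h : R => h * l) Lm.
have D : is_diff t f L.
  apply: near_differentiable.
    by move=> x; apply: cvgMr_tmp; exact: cvg_id.
  move=> e /H[d d0 Hd]; apply/nbhs_ballP; exists d => // h.
  by rewrite /ball /= sub0r normrN => /Hd.
have df : differentiable f t by case: D.
split; first exact: diff_derivable.
by rewrite deriveE // diff_val /= mul1r.
Qed.

Lemma normc_real (t : R) : nc t%:C = `|t|.
Proof. by rewrite /= expr0n addr0 sqrtr_sqr. Qed.

Definition complex_segment_integral (phi : C -> C) : C :=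
  itg 0 1 (fun t => complex.Re (phi t%:C)) +i* itg 0 1 (fun t => complex.Im (phi t%:C)).

Lemma segment_integral_complex :
  @segment_integral C ((fun t : R => t%:C : C) @` [set` `[0, 1]%R]) complex_segment_integral.
Proof.
set E := (X in segment_integral X).
have EP t : 0 <= t <= 1 -> E (t%:C) by move=> t01; exists t => //=; rewrite in_itv.
have cRe (phi : C -> C) : continuous_on E phi ->
    continuous_on_itv 0 1 (fun t => complex.Re (phi t%:C)).
  move=> cphi t t01; apply/cvgrPdist_le => e e0.
  have [d d0 Hd] := (continuousCP _ _).1 (cphi _ (EP _ t01)) e e0.
  apply/nbhs_ballP; exists d => // s; rewrite /ball /= => st.
  rewrite distrC -raddfB; apply: le_trans (normc_ge _).1 _.
  have := Hd (s - t)%:C; rewrite normc_real distrC => /(_ st).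
  by rewrite -rmorphD /= subrKC.
have cIm (phi : C -> C) : continuous_on E phi ->
    continuous_on_itv 0 1 (fun t => complex.Im (phi t%:C)).
  move=> cphi t t01; apply/cvgrPdist_le => e e0.
  have [d d0 Hd] := (continuousCP _ _).1 (cphi _ (EP _ t01)) e e0.
  apply/nbhs_ballP; exists d => // s; rewrite /ball /= => st.
  rewrite distrC -raddfB; apply: le_trans (normc_ge _).2 _.
  have := Hd (s - t)%:C; rewrite normc_real distrC => /(_ st).
  by rewrite -rmorphD /= subrKC.
have cZ (f : R -> R) k : continuous_on_itv 0 1 f -> continuous_on_itv 0 1 (fun t => k * f t).
  by move=> cf t t01; apply: cvgMl_tmp; exact: cf.
have cD (f g : R -> R) : continuous_on_itv 0 1 f -> continuous_on_itv 0 1 g ->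
   continuous_on_itv 0 1 (fun t => f t + g t).
  by move=> cf cg t t01; apply: cvgD; [exact: cf|exact: cg].
split.
- apply: continuous_compact; last exact: segment_compact.
  apply: continuous_subspaceT => t; apply/cvgrPdist_le => -[e ei].
  rewrite ltcE /= => /andP[/eqP -> e0]; apply/nbhs_ballP; exists e => // s.
  by rewrite /ball /= => /ltW; rewrite -rmorphB normc_normE normc_real lecR.
- move=> _ [t + <-]; rewrite /= in_itv /= => /andP[t0 t1].
  by rewrite normc_normE normc_real -[1]/(1%:C : C) lecR ger0_norm.
- move=> phi psi [c1 c2] cphi cpsi.
  have c := (cRe _ cphi, cIm _ cphi, cRe _ cpsi, cIm _ cpsi).
  have {c} [[[c1' c2'] c3'] c4'] := c.
  rewrite /complex_segment_integral.
  have -> : (fun t : R => complex.Re (phi t%:C + (c1 +i* c2) * psi t%:C)) =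
     fun t => complex.Re (phi t%:C) + (c1 * complex.Re (psi t%:C) + (- c2) * complex.Im (psi t%:C)).
    by apply/funext => t; case: (phi _) => ? ?; case: (psi _) => ? ? /=; ring.
  have -> : (fun t : R => complex.Im (phi t%:C + (c1 +i* c2) * psi t%:C)) =
     fun t => complex.Im (phi t%:C) + (c1 * complex.Im (psi t%:C) + c2 * complex.Re (psi t%:C)).
    by apply/funext => t; case: (phi _) => ? ?; case: (psi _) => ? ? /=; ring.
  rewrite !itgD ?itgZ //; try by [apply: cZ | apply: cD; exact: cZ].
  by apply/eqP; rewrite eq_complex /=; apply/andP; split; apply/eqP; ring.
- move=> phi [B Bi] cphi H.
  (* A complex number that dominates a norm in the order of [C] is real. *)
  have Bi0 : Bi = 0.
    have := H _ (EP 0 _); rewrite lexx ler01 normc_normE lecE /= => /(_ isT)/andP[/eqP ->].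
    by [].
  have HB t : 0 <= t <= 1 -> nc (phi t%:C) <= B.
    by move=> t01; have := H _ (EP t t01); rewrite Bi0 normc_normE lecR.
  (* Real and imaginary parts are bounded separately; this is the origin of the factor 2 in
     [segment_integral]. *)
  have B2 : (2 * (B +i* Bi) : C) = (B + B)%:C.
    by rewrite Bi0 mulr_natl mulr2n; apply/eqP; rewrite eq_complex /= addr0 !eqxx.
  rewrite B2 normc_normE lecR; apply: le_trans (normc_le _) _; apply: lerD.
    apply: norm_itg_le; first exact: cRe.
    by move=> t t01; apply: le_trans (normc_ge _).1 _; exact: HB.
  apply: norm_itg_le; first exact: cIm.
  by move=> t t01; apply: le_trans (normc_ge _).2 _; exact: HB.
- move=> psi dpsi H cd.
  have D t : 0 <= t <= 1 -> forall e : R, 0 < e -> exists2 d : R, 0 < d & forall h : R, `|h| < d ->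
      nc (psi (t + h)%:C - psi t%:C - h%:C * dpsi t%:C) <= e * `|h|.
    move=> t01 e e0; have [/derivable1_diffP dp <-] := H _ (EP t t01).
    have [d d0 Hd] := differentiableCP dp e0; exists d => // h hd.
    by have := Hd h%:C; rewrite normc_real -rmorphD -deriveE // => /(_ hd).
  rewrite /complex_segment_integral.
  have dRe (t : R) : 0 <= t <= 1 ->
      is_derive t 1 (fun t : R => complex.Re (psi t%:C)) (complex.Re (dpsi t%:C)).
    move=> t01; apply: is_derive_eps => e e0; have [d d0 Hd] := D t t01 e e0.
    exists d => // h hd; apply: le_trans (Hd h hd); apply: le_trans (normc_ge _).1.
    rewrite le_eqVlt; apply/orP; left; apply/eqP; congr `|_|.
    by case: (psi _) => ? ?; case: (psi _) => ? ?; case: (dpsi _) => ? ? /=; ring.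
  have dIm (t : R) : 0 <= t <= 1 ->
      is_derive t 1 (fun t : R => complex.Im (psi t%:C)) (complex.Im (dpsi t%:C)).
    move=> t01; apply: is_derive_eps => e e0; have [d d0 Hd] := D t t01 e e0.
    exists d => // h hd; apply: le_trans (Hd h hd); apply: le_trans (normc_ge _).2.
    rewrite le_eqVlt; apply/orP; left; apply/eqP; congr `|_|.
    by case: (psi _) => ? ?; case: (psi _) => ? ?; case: (dpsi _) => ? ? /=; ring.
  rewrite (itg_FTC (cRe _ cd) dRe) (itg_FTC (cIm _ cd) dIm).
  have -> : (1%:C : C) = 1 by [].
  have -> : (0%:C : C) = 0 by [].
  by case: (psi 1) => ? ?; case: (psi 0) => ? ?.
Qed.

Lemma exists_segment_integral b :
  exists (E : set (scalar_field R b)) I, segment_integral E I.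
Proof.
case: b; first by do 2!eexists; exact: segment_integral_real.
by do 2!eexists; exact: segment_integral_complex.
Qed.
End SegmentIntegrals.

(** * Function germs *)

Section Germs.
Context {R : realType} {b : scalars}.
Local Notation K := (scalar_field R b).

(** From here on one notion of smoothness serves both fields; over the complex numbers this is
    [holomorphic_derive] iterated. *)
Lemma smooth_onP (V : normedModType K) (U : set V) (f : V -> K) : open U ->
  smooth_on b U f <-> Cinfty U f.
Proof.
move=> oU; case: b V U f oU => V U f oU //=; split; last by move=> H; exact: (H 1%N).1.
move=> Hf k; elim: k f Hf => [|k IH] f Hf /=.
  by move=> x /Hf/differentiable_continuous.
split=> // v; apply: IH => x Ux; apply: holomorphic_derive.
by near=> y; apply: Hf; near: y; exact: open_nbhs_nbhs.
Unshelve. all: by end_near. Qed.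

Lemma smooth_on_rowP (V : normedModType K) p (U : set V) (f : V -> 'rV[K]_p) : open U ->
  smooth_on b U f <-> forall j, Cinfty U (fun x => f x 0 j).
Proof.
move=> oU; apply: (@iff_trans _ (forall j, smooth_on b U (fun x => f x 0 j : K))); last first.
  by split=> H j; [apply/smooth_onP|apply/(smooth_onP _ oU)].
case: b V U f oU => V U f oU /=.
  split=> [H j k|H k]; first exact: (Ck_rowP k f oU).1 (H k) j.
  by apply/(Ck_rowP k f oU) => j; exact: H.
split=> [H j x Ux|H x Ux]; first exact: (differentiable_rowP f x).1 (H x Ux) j.
by apply/differentiable_rowP => j; exact: H.
Qed.

(** [Ck] is a condition at each point separately, so it passes to arbitrary unions of open sets. *)
Lemma Ck_set1P (V W : normedModType K) k (U : set V) (f : V -> W) :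
  Ck k U f <-> forall x, U x -> Ck k [set x] f.
Proof.
elim: k f => [|k IH] f /=.
  by split=> [H x Ux _ ->|H x Ux]; [exact: H|exact: (H x Ux x)].
split=> [[df Df] x Ux|H].
  by split=> [_ ->|v]; [exact: df|exact: (IH _).1 (Df v) x Ux].
split=> [x Ux|v]; first exact: (H x Ux).1.
by apply/IH => x Ux; exact: (H x Ux).2.
Qed.

Context {n : nat}.
Local Notation V := 'rV[K]_n.
Variable S : set V.
Implicit Types (f g h : V -> K) (a x v : V).

(** The union of all open sets on which [g] is smooth is a common neighbourhood of the points of
    [S]. *)
Lemma function_germsP g : function_germs S g <->
  forall a, S a -> exists U, [/\ open U, U a & Cinfty U g].
Proof.
split=> [[U [oU SU /(smooth_onP _ oU) Cg]] a Sa|H].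
  by exists U; split => //; exact: SU.
pose U := [set x | exists N, [/\ open N, N x & Cinfty N g]].
have oU : open U.
  rewrite openE => x [N [oN Nx CN]]; apply: filterS (open_nbhs_nbhs (conj oN Nx)) => y Ny.
  by exists N.
exists U; split => //; apply/(smooth_onP _ oU) => k; apply/Ck_set1P => x [N [oN Nx CN]].
exact: (Ck_set1P k N g).1 (CN k) x Nx.
Qed.

Lemma germs_eq f g : germ_eq S f g -> function_germs S f -> function_germs S g.
Proof.
move=> fg /function_germsP Sf; apply/function_germsP => a Sa.
have [U [oU Ua Cf]] := Sf a Sa.
exists (U `&` (interior [set x | f x = g x])); split.
- by apply: openI => //; exact: open_interior.
- by split=> //; exact: fg.
- move=> k; apply: (@Ck_eq _ _ _ _ _ f).
  + by apply: openI => //; exact: open_interior.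
  + by move=> x [_ /interior_subset].
  + by apply: Ck_sub (Cf k); exact: subIsetl.
Qed.

Lemma germ_eq_derive f g v : germ_eq S f g -> germ_eq S ('D_v f) ('D_v g).
Proof.
move=> fg a Sa; have /near_join := fg a Sa.
by apply: filterS => x; exact: near_eq_derive.
Qed.

Lemma germs_cst c : function_germs S (fun=> c).
Proof. by exists setT; split; [exact: openT| |apply/smooth_onP; [exact: openT|move=> k; exact: Ck_cst]]. Qed.

Let germs_op2 (op : K -> K -> K) f g :
  (forall U k f g, open U -> @Ck _ V K k U f -> @Ck _ V K k U g -> Ck k U (fun x => op (f x) (g x))) ->
  function_germs S f -> function_germs S g -> function_germs S (fun x => op (f x) (g x)).
Proof.
move=> H [U [oU SU Cf]] [U' [oU' SU' Cg]]; have oI := openI oU oU'.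
exists (U `&` U'); split => //; first by move=> x Sx; split; [exact: SU|exact: SU'].
apply/(smooth_onP _ oI) => k; apply: H => //.
  by apply: (@Ck_sub _ _ _ U); [exact: subIsetl|exact: (smooth_onP _ oU).1].
by apply: (@Ck_sub _ _ _ U'); [exact: subIsetr|exact: (smooth_onP _ oU').1].
Qed.

Lemma germsD f g : function_germs S f -> function_germs S g ->
  function_germs S (fun x => f x + g x).
Proof. by apply: germs_op2; exact: CkD. Qed.

Lemma germsM f g : function_germs S f -> function_germs S g ->
  function_germs S (fun x => f x * g x).
Proof. by apply: germs_op2; exact: CkM. Qed.

Lemma germs_sum (T : finType) (F : T -> V -> K) :
  (forall t, function_germs S (F t)) -> function_germs S (fun x => \sum_t F t x).
Proof.
move=> HF; elim: (index_enum T) => [|t s IH].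
  by under eq_fun do rewrite big_nil; exact: germs_cst.
by under eq_fun do rewrite big_cons; exact: germsD.
Qed.

Lemma germs_derive f v : function_germs S f -> function_germs S ('D_v f).
Proof.
move=> [U [oU SU /(smooth_onP _ oU) Cf]]; exists U; split => //.
by apply/(smooth_onP _ oU) => k; exact: (Cf k.+1).2.
Qed.

Lemma germs_differentiable f : function_germs S f ->
  forall a, S a -> \forall x \near a, differentiable f x.
Proof.
move=> [U [oU SU /(smooth_onP _ oU) Cf]] a Sa.
near=> x; apply: (Cf 1%N).1; near: x; apply: open_nbhs_nbhs; split=> //; exact: SU.
Unshelve. all: by end_near. Qed.

Lemma smooth_germ_rowP p (f : V -> 'rV[K]_p) :
  smooth_germ b S f <-> forall j, function_germs S (fun x => f x 0 j).
Proof.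
split=> [[U [oU SU /(smooth_on_rowP _ oU) Cf]] j|H].
  by exists U; split => //; exact/smooth_onP.
have [U HU] := choice H.
pose O := \bigcap_j U j.
have oO : open O.
  rewrite openE => x Ox; rewrite /interior; near=> y; move=> j _; move: j; near: y.
  apply: filter_forall => j; apply: open_nbhs_nbhs; split; last exact: Ox.
  by have [] := HU j.
exists O; split => //.
  by move=> x Sx j _; have [_ SU _] := HU j; exact: SU.
apply/(smooth_on_rowP _ oO) => j k; have [oU _ /(smooth_onP _ oU) C] := HU j.
by apply: Ck_sub (C k); exact: bigcap_inf.
Unshelve. all: by end_near. Qed.

Lemma row_germs_differentiable p (f : V -> 'rV[K]_p) : smooth_germ b S f ->
  forall a, S a -> \forall x \near a, differentiable f x.
Proof.
move=> /smooth_germ_rowP H a Sa; near=> x; apply/differentiable_rowP.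
near: x; apply: filter_forall => j; exact: germs_differentiable.
Unshelve. all: by end_near. Qed.

Lemma row_germs_derive p (f : V -> 'rV[K]_p) v : smooth_germ b S f ->
  smooth_germ b S ('D_v f).
Proof.
move=> Sf; apply/smooth_germ_rowP => j.
apply: (@germs_eq ('D_v (fun x => f x 0 j))); last first.
  by apply: germs_derive; exact: (smooth_germ_rowP f).1.
by move=> a /(row_germs_differentiable Sf); apply: filterS => x df; rewrite derive_row.
Qed.

Lemma germs_comp p (psi : 'rV[K]_p -> K) (f : V -> 'rV[K]_p) :
  multigerm S f -> function_germs [set 0] psi -> function_germs S (psi \o f).
Proof.
move=> [[U [oU SU /(smooth_on_rowP _ oU) Cf]] f0] [U' [oU' SU' /(smooth_onP _ oU') Cpsi]].
apply/function_germsP => a Sa.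
have cf : {for a, continuous f}.
  have C0 : Ck 0 U f by apply/(Ck_rowP 0 f oU) => j; exact: Cf.
  by apply: C0; exact: SU.
exists (U `&` (interior (f @^-1` U'))).
have oI : open (U `&` (interior (f @^-1` U'))) by apply: openI => //; exact: open_interior.
split => //.
  split; first exact: SU.
  by apply: cf; apply: open_nbhs_nbhs; split => //; rewrite f0 //; exact: SU'.
move=> k; apply: (Ck_comp oI oU') => //.
  by move=> x [_ /interior_subset].
by apply/(Ck_rowP k f oI) => j; apply: Ck_sub (Cf j k); exact: subIsetl.
Qed.
End Germs.

(** * Germs vanishing to a given order *)

Section Vanishing.
Context {R : realType} {b : scalars} {n : nat}.
Local Notation K := (scalar_field R b).
Local Notation V := 'rV[K]_n.
Variable S : set V.
Implicit Types (f g h : V -> K) (a x v : V).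

(** Membership in m_S^l, with derivatives in all directions instead of Taylor
    terms, which makes Leibniz' rule available. *)
Fixpoint vanishes (l : nat) g : Prop :=
  function_germs S g /\
  if l is l'.+1 then (forall a, S a -> g a = 0) /\ (forall v, vanishes l' ('D_v g))
  else True.

Lemma vanishes_germ l g : vanishes l g -> function_germs S g.
Proof. by case: l => [|l] []. Qed.

Lemma vanishes_eq l f g : germ_eq S f g -> vanishes l f -> vanishes l g.
Proof.
elim: l f g => [|l IH] f g fg [Sf H] /=; first by split=> //; exact: germs_eq Sf.
split; first exact: germs_eq Sf.
split=> [a Sa|v]; first by rewrite -(nbhs_singleton (fg a Sa)); exact: H.1.
by apply: (IH ('D_v f)); [exact: germ_eq_derive|exact: H.2].
Qed.

Lemma vanishesW l g : vanishes l.+1 g -> vanishes l g.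
Proof.
elim: l g => [|l IH] g [Sg [g0 Dg]]; first by [].
by split=> //; split=> // v; exact: IH.
Qed.

Lemma germ_eq_deriveD f g v : function_germs S f -> function_germs S g ->
  germ_eq S (fun x => 'D_v f x + 'D_v g x) ('D_v (fun x => f x + g x)).
Proof.
move=> Sf Sg a Sa.
apply: filterS2 (germs_differentiable Sf Sa) (germs_differentiable Sg Sa) => x df dg.
by rewrite (@deriveD _ _ _ f g) //; exact: diff_derivable.
Qed.

Lemma germ_eq_deriveM f g v : function_germs S f -> function_germs S g ->
  germ_eq S (fun x => f x * 'D_v g x + 'D_v f x * g x) ('D_v (fun x => f x * g x)).
Proof.
move=> Sf Sg a Sa.
apply: filterS2 (germs_differentiable Sf Sa) (germs_differentiable Sg Sa) => x df dg.
rewrite (@deriveM _ _ f g); [|exact: diff_derivable|exact: diff_derivable].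
by congr (_ + _); rewrite mulrC.
Qed.

Lemma vanishesD l f g : vanishes l f -> vanishes l g -> vanishes l (fun x => f x + g x).
Proof.
elim: l f g => [|l IH] f g [Sf Hf] [Sg Hg]; first by split=> //; exact: germsD.
split; first exact: germsD.
split=> [a Sa|v]; first by rewrite Hf.1 // Hg.1 // addr0.
apply: vanishes_eq (germ_eq_deriveD v Sf Sg) _.
by apply: IH; [exact: Hf.2|exact: Hg.2].
Qed.

Lemma vanishes_mul l f g : vanishes l f -> function_germs S g ->
  vanishes l (fun x => f x * g x).
Proof.
elim: l f g => [|l IH] f g Hf Sg; have [Sf Df] := Hf; first by split=> //; exact: germsM.
split; first exact: germsM.
split=> [a Sa|v]; first by rewrite Df.1 // mul0r.
apply: vanishes_eq (germ_eq_deriveM v Sf Sg) _.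
apply: vanishesD; first by apply: IH; [exact: vanishesW|exact: germs_derive].
by apply: IH => //; exact: Df.2.
Qed.

(** By Leibniz' rule the derivative is [f * 'D_v g + 'D_v f * g]: the first term inherits the order
    of [f], and in the second the order lost by ['D_v f] is regained from [g]. *)
Lemma vanishesS l f g : vanishes l f -> vanishes 1 g -> vanishes l.+1 (fun x => f x * g x).
Proof.
elim: l f => [|l IH] f Hf Hg; have [Sf Df] := Hf; have [Sg [g0 Dg]] := Hg.
  split; first exact: germsM.
  split=> [a Sa|v]; first by rewrite g0 // mulr0.
  split=> //; apply: germs_derive; exact: germsM.
split; first exact: germsM.
split=> [a Sa|v]; first by rewrite g0 // mulr0.
apply: vanishes_eq (germ_eq_deriveM v Sf Sg) _.
apply: vanishesD; last by apply: IH => //; exact: Df.2.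
by apply: vanishes_mul => //; exact: germs_derive.
Qed.

Lemma vanishes_sum (T : finType) l (F : T -> V -> K) :
  (forall t, vanishes l (F t)) -> vanishes l (fun x => \sum_t F t x).
Proof.
move=> HF; elim: (index_enum T) => [|t s IH].
  under eq_fun do rewrite big_nil.
  elim: l {HF} => [|l IH]; (split; first exact: germs_cst) => //.
  by split=> // v; rewrite (_ : 'D_v _ = fun=> 0) //; apply/funext => x; rewrite derive_cst.
by under eq_fun do rewrite big_cons; exact: vanishesD.
Qed.

Lemma vanishes_mpow l g : vanishes l g -> mpow S l g.
Proof.
move=> Hg; split; first exact: vanishes_germ Hg.
move=> a Sa k kl v; rewrite /taylor_term; apply/eqP; rewrite scaler_eq0; apply/orP; right.
elim: k l g Hg kl => [|k IH] [|l] g [Sg Hg] // kl; first by rewrite /= Hg.1.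
by rewrite iterSr; apply: (IH l); [exact: Hg.2|].
Qed.
End Vanishing.

(** * Localization at the points of S *)

Section Localization.
Context {R : realType} {b : scalars} {n : nat}.
Local Notation K := (scalar_field R b).
Local Notation V := 'rV[K]_n.

Lemma pos_lower_bound (F : numFieldType) (s : seq F) : (forall x, x \in s -> 0 < x) ->
  exists2 rho, 0 < rho & forall x, x \in s -> rho <= x.
Proof.
elim: s => [|x s IH] H; first by exists 1.
have x0 : 0 < x by apply: H; rewrite mem_head.
have [|rho rho0 Hrho] := IH; first by move=> y ys; apply: H; rewrite in_cons ys orbT.
have D : 0 < rho + x by rewrite addr_gt0.
(* This lies below both [rho] and [x], and replaces their minimum since the order of [F] need not be
   total. *)
exists (rho * x / (rho + x)); first by rewrite divr_gt0 // mulr_gt0.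
move=> y; rewrite in_cons => /predU1P[->|/Hrho].
  by rewrite ler_pdivrMr // [_ * (_ + _)]mulrC ler_wpM2r ?(ltW x0) // lerDl ltW.
apply: le_trans; rewrite ler_pdivrMr // ler_wpM2l ?(ltW rho0) //.
by rewrite lerDr ltW.
Qed.

(** Only values near [S] matter, so indicator functions of balls of half the least distance will do.
    They are constant near each point of [S], hence holomorphic germs too, where bump functions
    would be impossible. *)
Lemma separating_functions (S : set V) : finite_set S ->
  exists (m : nat) (a : 'I_m -> V) (chi : 'I_m -> V -> K),
    [/\ S = range a &
        forall i, \forall x \near a i, forall k, chi k x = (k == i)%:R].
Proof.
move=> /finite_seqP[s0 Ss0].
pose s := undup s0.
have Ss : S = [set` s].
  by rewrite Ss0; apply/seteqP; split => x /=; rewrite mem_undup.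
pose dists := [seq `|x.1 - x.2| | x <- allpairs pair s s & x.1 != x.2].
have [d [d0 Hd]] : exists d : K, 0 < d /\ forall x, x \in dists -> d <= x.
  have [|d d0 Hd] := @pos_lower_bound K dists; last by exists d.
  move=> t /mapP[[x y] /=]; rewrite mem_filter /= => /andP[xy _] ->.
  by rewrite normr_gt0 subr_eq0.
pose a (i : 'I_(size s)) := nth 0 s i.
have as_ i : a i \in s by exact: mem_nth.
have inja i k : a i = a k -> i = k.
  by move=> /eqP; rewrite nth_uniq ?undup_uniq // => /eqP/val_inj.
have dist i k : i != k -> d <= `|a i - a k|.
  move=> ik; apply: Hd; apply/mapP; exists (a i, a k) => //.
  rewrite mem_filter /=; apply/andP; split; last by apply/allpairsP; exists (a i, a k); split => /=.
  by apply: contra_neq ik => /inja.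
exists (size s), a, (fun k x => (`|a k - x| < d / 2)%R%:R); split.
  rewrite Ss; apply/seteqP; split => [x /= xs|_ [i _ <-]]; last exact: as_.
  have xi : (index x s < size s)%N by rewrite index_mem.
  by exists (Ordinal xi) => //; rewrite /a nth_index.
move=> i; apply/nbhs_ballP; exists (d / 2); first by rewrite /= divr_gt0.
move=> x; rewrite -ball_normE /= => xi k; suff -> : (`|a k - x| < d / 2)%R = (k == i) by [].
have [->|ki] := eqVneq k i; first exact: xi.
apply/negbTE/negP => xk; have := dist k i ki; apply/negP; rewrite -real_ltNge ?normr_real ?gtr0_real //.
rewrite [d]splitr; have -> : a k - a i = (a k - x) - (a i - x) by rewrite opprB addrA subrK.
by apply: le_lt_trans (ler_normB _ _) _; exact: ltrD.
Qed.

(** The coordinates centred at the various points are glued into one germ [X j] each, so that [n]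
    germs serve for all of [S]; the constants [c i] are the values of [g] at the points. *)
Lemma hadamard_germs (S : set V) : finite_set S ->
  exists (m : nat) (chi : 'I_m -> V -> K) (X : 'I_n -> V -> K),
  [/\ forall i, function_germs S (chi i), forall j, vanishes S 1 (X j) &
   forall g, function_germs S g -> exists (c : 'I_m -> K) (h : 'I_n -> V -> K),
     (forall j, function_germs S (h j)) /\
     germ_eq S g (fun x => \sum_i c i * chi i x + \sum_j X j x * h j x)].
Proof.
move=> /separating_functions[m [a [chi [Sa Hchi]]]].
have Si i : S (a i) by rewrite Sa; exists i.
have forS (P : V -> Prop) : (forall i, P (a i)) -> forall x, S x -> P x.
  by move=> H x; rewrite Sa => -[i _ <-].
have pick i (F : 'I_m -> V -> K) :
    \forall x \near a i, F i x = \sum_k chi k x * F k x.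
  near=> x; have Hx : forall k, chi k x = (k == i)%:R by near: x; exact: Hchi.
  rewrite (bigD1 i) //= Hx eqxx mul1r big1 ?addr0 // => k ki.
  by rewrite Hx (negbTE ki) mul0r.
(* Smoothness of the [i]-th piece at [a i] alone is enough, since near [a i] the glued function
   equals [F i]. *)
have glue (F : 'I_m -> V -> K) :
    (forall i, exists U, [/\ open U, U (a i) & Cinfty U (F i)]) ->
    function_germs S (fun x => \sum_k chi k x * F k x).
  move=> HF; apply/function_germsP; apply: forS => i.
  have SF : function_germs [set a i] (F i).
    by apply/function_germsP => _ ->; exact: HF.
  have /function_germsP : function_germs [set a i] (fun x => \sum_k chi k x * F k x).
    by apply: germs_eq SF => _ ->; exact: pick.
  exact.
have gcst (c : K) : exists U : set V, [/\ open U, U 0 & Cinfty U (fun=> c : K)].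
  by exists setT; split => //; [exact: openT|move=> k; exact: Ck_cst].
pose X j x := \sum_k chi k x * (x - a k) 0 j.
have coord_smooth (c : V) j : Cinfty [set: V] (fun x => (x - c) 0 j : K).
  have /smooth_germ_rowP/(_ j) : smooth_germ b [set: V] (fun x : V => x - c).
    exists setT; split => //; first exact: openT.
    apply/smooth_on_rowP; first exact: openT.
    move=> i k; apply: (@Ck_eq _ _ _ _ _ (fun x : V => x 0 i + (- c 0 i))).
    - exact: openT.
    - by move=> x _; rewrite !mxE.
    apply: CkD; [exact: openT| |exact: Ck_cst].
    have Llin : linear (fun x : V => x 0 i : K) by move=> t A B; rewrite !mxE.
    pose Lm := GRing.isLinear.Build K V K *:%R _ Llin.
    pose L : {linear V -> K} := HB.pack (fun x : V => x 0 i : K) Lm.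
    by apply: (@Ck_linear _ _ _ _ L); exact: coord_continuous.
  move=> [U [oU SU /(smooth_onP _ oU) C]] k.
  exact: Ck_sub (C k).
have SX j : function_germs S (X j).
  apply: glue => i; exists setT; split => //; exact: openT.
exists m, chi, X; split.
- move=> i; apply/function_germsP; apply: forS => k.
  have : function_germs [set a k] (chi i).
    apply: (@germs_eq _ _ _ _ (fun=> (i == k)%:R)); last exact: germs_cst.
    by move=> _ ->; near=> x; apply/esym; move: i; near: x; exact: Hchi.
  by move=> /function_germsP; exact.
- move=> j; split; first exact: SX.
  split; last by move=> v; split => //; exact: germs_derive.
  apply: forS => i; have /= := nbhs_singleton (pick i (fun k x => (x - a k) 0 j)).
  by rewrite subrr mxE => /esym.
move=> g /function_germsP Sg.
have [E [I EI]] := exists_segment_integral (R := R) b.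
pose F j k := segment_average (I := I) (a k) 0 ('D_(delta_mx 0 j) g).
have balls i : exists2 d : K, 0 < d & Cinfty (ball (a i) d) g.
  have [U [oU Ui CU]] := Sg _ (Si i).
  have /nbhs_ballP[d d0 Hd] := open_nbhs_nbhs (conj oU Ui).
  by exists d => // k; exact: Ck_sub (CU k).
exists (fun i => g (a i)), (fun j x => \sum_k chi k x * F j k x); split.
  move=> j; apply: glue => i; have [d d0 Cd] := balls i.
  exists (ball (a i) d); split; [exact: ball_open|exact: ballxx|].
  by apply: (Cinfty_segment_average EI) => k; exact: (Cd k.+1).2.
apply: forS => i; have [d d0 Cd] := balls i.
have nearX := filter_forall (nbhs_filter (a i)) (fun j => pick i (fun k x => (x - a k) 0 j)).
have nearF := filter_forall (nbhs_filter (a i)) (fun j => pick i (F j)).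
have nearB := open_nbhs_nbhs (conj (ball_open (a i) d) (ballxx (a i) d0)).
have nearG := pick i (fun k _ => g (a k)).
apply: filterS2 (filterI nearX nearF) (filterI nearB nearG) => x [HX HF] [bx HG].
rewrite (hadamard_ball EI Cd (ballxx _ d0) bx); congr (_ + _).
  transitivity (\sum_k chi k x * g (a k)).
    exact: HG.
  by apply: eq_bigr => k _; rewrite mulrC.
by apply: eq_bigr => j _; rewrite HX /segment_average -HF.
Unshelve. all: by end_near. Qed.
End Localization.

(** * Finite generation *)

Section Generation.
Context {R : realType} {b : scalars} {n : nat}.
Local Notation K := (scalar_field R b).
Local Notation V := 'rV[K]_n.

(** Hadamard's lemma is iterated on the coefficients [h]. Thus [q] lists the monomials of degree [l]
    in the [X j], and [e] the monomials of lower degree times the [chi i]. *)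
Lemma germs_modulo_vanishing (S : set V) (l : nat) : finite_set S ->
  exists (T1 T2 : finType) (e : T1 -> V -> K) (q : T2 -> V -> K),
  [/\ forall t, function_germs S (e t), forall t, vanishes S l (q t) &
   forall g, function_germs S g -> exists (c : T1 -> K) (h : T2 -> V -> K),
     (forall t, function_germs S (h t)) /\
     germ_eq S g (fun x => \sum_t c t * e t x + \sum_t q t x * h t x)].
Proof.
move=> finS; elim: l => [|l [T1 [T2 [e [q [Se Vq gen]]]]]].
  exists void, unit, (fun _ _ => 0), (fun _ _ => 1); split.
  - by case.
  - by move=> _; split => //; exact: germs_cst.
  move=> g Sg; exists (fun=> 0), (fun=> g); split => // a Sa; near=> x.
  by rewrite big_pred0 => [|[]] //; rewrite big_const card_unit /= mul1r addr0 add0r.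
have [m [chi [X [Schi VX had]]]] := hadamard_germs finS.
exists (T1 + T2 * 'I_m)%type, (T2 * 'I_n)%type,
  (fun t x => match t with inl t => e t x | inr u => q u.1 x * chi u.2 x end),
  (fun t x => q t.1 x * X t.2 x); split.
- case=> [t|[t i]] /=; first exact: Se.
  by apply: germsM => //; exact: vanishes_germ (Vq t).
- by move=> [t j]; exact: vanishesS.
move=> g /gen[c [h [Sh gE]]].
have [d /choice[k Hk]] := choice (fun t => had (h t) (Sh t)).
exists (fun t => match t with inl t => c t | inr u => d u.1 u.2 end), (fun t => k t.1 t.2).
split=> [[t j]|a Sa]; first by have [] := Hk t.
have hE := filter_forall (nbhs_filter a) (fun t => (Hk t).2 a Sa).
apply: filterS2 (gE a Sa) hE => x -> {}hE.
rewrite big_sumType /= -addrA; congr (_ + _).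
rewrite -(pair_bigA _ (fun t i => d t i * (q t x * chi i x))) /=.
rewrite -(pair_bigA _ (fun t j => q t x * X j x * k t j x)) /= -big_split /=.
apply: eq_bigr => t _; rewrite hE mulrDr !mulr_sumr; congr (_ + _).
  by apply: eq_bigr => i _; rewrite mulrCA.
by apply: eq_bigr => j _; rewrite mulrA.
Unshelve. all: by end_near. Qed.
End Generation.

(** Take a matrix of maximal rank among those with all rows in [P]: appending a vector of [P]
    outside its row space would raise the rank. *)
Lemma rV_submodule_row_space (F : fieldType) (d : nat) (P : 'rV[F]_d -> Prop) :
  P 0 -> (forall c u v, P u -> P v -> P (c *: u + v)) ->
  exists k (A : 'M[F]_(k, d)), (forall i, P (row i A)) /\
    forall v, P v -> exists u, v = u *m A.
Proof.
move=> P0 PD.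
pose Q r := `[< exists k (A : 'M[F]_(k, d)), (forall i, P (row i A)) /\ \rank A = r >].
have Q0 : exists r, Q r.
  by exists 0%N; apply/asboolP; exists 0%N, 0; split=> [[]|]; rewrite ?mxrank0.
have Qd r : Q r -> (r <= d)%N by move=> /asboolP[k [A [_ <-]]]; exact: rank_leq_col.
case: (ex_maxnP Q0 Qd) => r /asboolP[k [A [PA rA]]] rmax.
exists k, A; split => // v Pv; apply/submxP; apply/negPn/negP => vA.
have : Q (\rank (col_mx A v)).
  apply/asboolP; exists (k + 1)%N, (col_mx A v); split => // i.
  by case: (split_ordP i) => j ->; rewrite ?rowKu ?rowKd // row_id // ord1.
move=> /rmax; rewrite -rA leqNgt => /negP; apply.
have AA : (A <= col_mx A v)%MS by rewrite -addsmxE addsmxSl.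
rewrite ltn_neqAle !(mxrank_leqif_sup AA) andbT; apply: contra vA => /(submx_trans _); apply.
by rewrite -addsmxE addsmxSr.
Qed.

(** * The modules TR_e(f) and TL_e(f) *)

Section Main.
Context {R : realType} {b : scalars} {n p : nat}.
Local Notation K := (scalar_field R b).
Local Notation V := 'rV[K]_n.
Variables (S : set V) (f : V -> 'rV[K]_p).
Hypotheses (finS : finite_set S) (mf : multigerm S f).

Let Sf : smooth_germ b S f. Proof. by case: mf. Qed.

Let partial m : V -> 'rV[K]_p := 'D_(delta_mx 0 m) f.

Lemma germs_via psi : function_germs [set 0] psi -> function_germs S (psi \o f).
Proof. exact: germs_comp. Qed.

Lemma germ_eq_tf (xi : V -> V) : germ_eq S (tf f xi) (fun x => \sum_m xi x 0 m *: partial m x).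
Proof.
move=> a /(row_germs_differentiable Sf); apply: filterS => x df.
exact: diff_row_sum.
Qed.

Lemma TRe_partial_comb (y : 'I_n -> V -> K) zeta : (forall m, function_germs S (y m)) ->
  germ_eq S zeta (fun x => \sum_m y m x *: partial m x) -> TRe S f zeta.
Proof.
move=> Sy zE; exists (fun x => \row_m y m x).
  apply/smooth_germ_rowP => m; apply: germs_eq (Sy m) => a Sa; near=> x.
  by rewrite mxE.
move=> a Sa; apply: filterS2 (zE a Sa) (@germ_eq_tf (fun x => \row_m y m x) a Sa) => x -> ->.
by apply: eq_bigr => m _; rewrite mxE.
Unshelve. all: by end_near. Qed.

Lemma TRe_partialP zeta : TRe S f zeta -> exists2 y : 'I_n -> V -> K,
  forall m, function_germs S (y m) & germ_eq S zeta (fun x => \sum_m y m x *: partial m x).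
Proof.
move=> [xi Sxi zE]; exists (fun m x => xi x 0 m); first exact/smooth_germ_rowP.
by move=> a Sa; apply: filterS2 (zE a Sa) (@germ_eq_tf xi a Sa) => x ->.
Qed.

(** The product of [psi \o f] and [eta \o f] is the pull-back of [psi] times [eta]. Constant [psi]
    give closure under K-linear combinations. *)
Lemma TLe_comb (T : finType) (psi : T -> 'rV[K]_p -> K) (e : T -> V -> 'rV[K]_p) zeta :
  (forall t, function_germs [set 0] (psi t)) -> (forall t, TLe S f (e t)) ->
  germ_eq S zeta (fun x => \sum_t via f (psi t) (e t) x) -> TLe S f zeta.
Proof.
move=> Spsi He zE.
(* The inner match turns [exists2] into the plain existential that [choice] expects. *)
have [eta Heta] := choice (fun t => (fun H => let: ex_intro2 x y z := H in
   ex_intro (fun eta => theta_id [set 0] eta /\ germ_eq S (e t) (wf f eta)) x (conj y z)) (He t)).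
exists (fun y => \sum_t psi t y *: eta t y).
  apply/smooth_germ_rowP => j.
  apply: (@germs_eq _ _ _ _ (fun y => \sum_t psi t y * eta t y 0 j)).
    move=> a _; near=> y; rewrite summxE; apply: eq_bigr => t _; by rewrite mxE.
  apply: germs_sum => t; apply: germsM => //.
  by have [/smooth_germ_rowP] := Heta t.
move=> a Sa; have hE := filter_forall (nbhs_filter a) (fun t => (Heta t).2 a Sa).
apply: filterS2 (zE a Sa) hE => x -> {}hE.
by rewrite /wf /=; apply: eq_bigr => t _; rewrite /via hE.
Unshelve. all: by end_near. Qed.

(** TR_e(f) is even a module over C_{n,S}, which contains the pull-backs [psi \o f]. *)
Lemma TRe_comb (T : finType) (psi : T -> 'rV[K]_p -> K) (e : T -> V -> 'rV[K]_p) zeta :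
  (forall t, function_germs [set 0] (psi t)) -> (forall t, TRe S f (e t)) ->
  germ_eq S zeta (fun x => \sum_t via f (psi t) (e t) x) -> TRe S f zeta.
Proof.
move=> Spsi He zE.
have [y Hy] := choice (fun t => (fun H => let: ex_intro2 x y z := H in
   ex_intro (fun y => (forall m, function_germs S (y m)) /\
     germ_eq S (e t) (fun x => \sum_m y m x *: partial m x)) x (conj y z)) (TRe_partialP (He t))).
apply: (@TRe_partial_comb (fun m x => \sum_t psi t (f x) * y t m x)).
  move=> m; apply: germs_sum => t; apply: germsM; first exact: germs_via.
  exact: (Hy t).1.
move=> a Sa; have hE := filter_forall (nbhs_filter a) (fun t => (Hy t).2 a Sa).
apply: filterS2 (zE a Sa) hE => x -> {}hE.
under [RHS]eq_bigr do rewrite scaler_suml.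
rewrite exchange_big /=; apply: eq_bigr => t _.
rewrite /via hE scaler_sumr; apply: eq_bigr => m _; by rewrite scalerA.
Qed.

Lemma TRe_partial_sum (T : finType) (z : T -> V -> K) (mm : T -> 'I_n) :
  (forall t, function_germs S (z t)) ->
  TRe S f (fun x => \sum_t z t x *: partial (mm t) x).
Proof.
move=> Sz; apply: (@TRe_partial_comb (fun m x => \sum_t (mm t == m)%:R * z t x)).
  by move=> m; apply: germs_sum => t; apply: germsM => //; exact: germs_cst.
move=> a _; near=> x; under [RHS]eq_bigr do rewrite scaler_suml.
rewrite exchange_big /=; apply: eq_bigr => t _.
rewrite (bigD1 (mm t)) //= eqxx mul1r big1 ?addr0 // => m mt.
by rewrite eq_sym (negbTE mt) mul0r scale0r.
Unshelve. all: by end_near. Qed.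

Lemma TRe_scale_partial g m : function_germs S g -> TRe S f (fun x => g x *: partial m x).
Proof.
move=> Sg; have := @TRe_partial_sum 'I_1 (fun=> g) (fun=> m) (fun=> Sg).
by rewrite (_ : (fun x => _) = fun x => g x *: partial m x) //; apply/funext => x; rewrite big_ord1.
Qed.

Lemma finitely_generated_via_finType (T : finType) (e : T -> V -> 'rV[K]_p)
    (M : set (V -> 'rV[K]_p)) :
  (forall zeta, M zeta <-> exists2 psi : T -> 'rV[K]_p -> K,
     forall t, function_germs [set 0] (psi t)
     & germ_eq S zeta (fun x => \sum_t via f (psi t) (e t) x)) ->
  finitely_generated_via S f M.
Proof.
move=> HM; exists #|T|, (fun i => e (enum_val i)); apply/seteqP; split => zeta.
  move=> /HM[psi Spsi zE]; exists (fun i => psi (enum_val i)) => // a Sa.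
  apply: filterS (zE a Sa) => x ->.
  by rewrite (reindex _ (onW_bij _ (@enum_val_bij T))).
move=> [psi Spsi zE]; apply/HM; exists (fun t => psi (enum_rank t)) => // a Sa.
apply: filterS (zE a Sa) => x ->.
rewrite [RHS](reindex _ (onW_bij _ (@enum_val_bij T))) /=.
by apply: eq_bigr => i _; rewrite enum_valK.
Qed.

Section Determined.
Variable l : nat.
Hypothesis det : ideal_mul S (mpow S l) (theta S f) `<=` TLe S f.

Lemma vanishing_scale_TLe g zeta : vanishes S l g -> smooth_germ b S zeta ->
  TLe S f (fun x => g x *: zeta x).
Proof.
move=> Vg Sz; apply: det; exists 1%N, (fun=> g), (fun=> zeta); split => //.
  by move=> _; exact: vanishes_mpow.
by move=> a Sa; near=> x; rewrite big_ord1.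
Unshelve. all: by end_near. Qed.

Lemma vanishing_pullback (j : 'I_p) g : vanishes S l g ->
  exists2 psi, function_germs [set 0] psi & germ_eq S g (psi \o f).
Proof.
move=> Vg.
have Sd : smooth_germ b S (fun _ : V => delta_mx 0 j : 'rV[K]_p).
  by apply/smooth_germ_rowP => i; exact: germs_cst.
have [eta Seta gE] := vanishing_scale_TLe Vg Sd.
exists (fun y => eta y 0 j); first exact: (smooth_germ_rowP _ _).1 Seta j.
move=> a Sa; apply: filterS (gE a Sa) => x /(congr1 (fun M : 'rV[K]_p => M 0 j)).
by rewrite !mxE !eqxx mulr1.
Qed.

Theorem TRe_TLe_finitely_generated (j0 : 'I_p) :
  finitely_generated_via S f (TRe S f `&` TLe S f).
Proof.
have [T1 [T2 [e [q [Se Vq gen]]]]] := germs_modulo_vanishing l finS.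
have Sq t : function_germs S (q t) by exact: vanishes_germ (Vq t).
have Sp m : smooth_germ b S (partial m) by exact: row_germs_derive.
(* Coefficients form a row vector indexed by the pairs [(t, m)], so that those with [comb c] in
   TL_e(f) are a subspace to which [rV_submodule_row_space] applies. *)
pose comb (c : 'rV[K]_#|{: T1 * 'I_n}|) x :=
  \sum_u (c 0 (enum_rank u) * e u.1 x) *: partial u.2 x.
have [||k [A [PA Agen]]] := @rV_submodule_row_space K _ (fun c => TLe S f (comb c)).
- apply: (@TLe_comb void (fun _ _ => 0) (fun _ _ => 0)) => [[]|[]|a Sa]; near=> x.
  rewrite big_pred0 => [|[]] //; rewrite /comb big1 // => u _.
  by rewrite mxE mul0r scale0r.
- move=> c u v Pu Pv.
  apply: (@TLe_comb bool (fun t _ => if t then c else 1) (fun t => if t then comb u else comb v)).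
  + by case; exact: germs_cst.
  + by case.
  move=> a Sa; near=> x; rewrite big_bool /via scale1r /comb scaler_sumr -big_split /=.
  by apply: eq_bigr => w _; rewrite !mxE mulrDl scalerDl scalerA mulrA.
pose G (t : 'I_k + (T2 * T1 * 'I_n + T2 * 'I_n)) : V -> 'rV[K]_p :=
  match t with
  | inl i => comb (row i A)
  | inr (inl w) => fun x => (q w.1.1 x * e w.1.2 x) *: partial w.2 x
  | inr (inr w) => fun x => q w.1 x *: partial w.2 x
  end.
have GR t : TRe S f (G t).
  case: t => [i|[w|w]] /=.
  - apply: (@TRe_partial_sum _ (fun u x => row i A 0 (enum_rank u) * e u.1 x) (fun u => u.2)).
    by move=> u; apply: germsM => //; exact: germs_cst.
  - by apply: TRe_scale_partial; exact: germsM.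
  - exact: TRe_scale_partial.
have GL t : TLe S f (G t).
  case: t => [i|[w|w]] /=; first exact: PA.
    by apply: vanishing_scale_TLe => //; exact: vanishes_mul.
  exact: vanishing_scale_TLe.
apply: (@finitely_generated_via_finType _ G) => zeta; split; last first.
  by move=> [psi Spsi zE]; split; [exact: TRe_comb zE|exact: TLe_comb zE].
move=> [/TRe_partialP[y Sy zE] zL].
have [c /choice[h Hh]] := choice (fun m => gen (y m) (Sy m)).
(* A second expansion, because the coefficients [h] of the first are arbitrary germs at [S]. Its
   remainder, the sum of [q t * r w t], vanishes to order [l] and is therefore a pull-back. *)
have [d Hd] := choice (fun w : 'I_n * T2 => gen (h w.1 w.2) ((Hh w.1).1 w.2)).
have [r Hr] := choice Hd.
have [psi Hpsi] := choice (fun w => (fun H => let: ex_intro2 x y z := H in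
   ex_intro (fun psi => function_germs [set 0] psi /\
     germ_eq S (fun x => \sum_t q t x * r w t x) (psi \o f)) x (conj y z))
   (vanishing_pullback j0 (vanishes_sum (fun t => vanishes_mul (Vq t) ((Hr w).1 t))))).
pose cc : 'rV[K]_#|{: T1 * 'I_n}| := \row_i c (enum_val i).2 (enum_val i).1.
(* The fields with a factor [e t] take constant coefficients; those with [q] alone take the
   pull-backs found above. *)
pose Psi (t : T2 * T1 * 'I_n + T2 * 'I_n) : 'rV[K]_p -> K :=
  match t with
  | inl w => fun=> d (w.2, w.1.1) w.1.2
  | inr w => psi (w.2, w.1)
  end.
have SPsi t : function_germs [set 0] (Psi t).
  by case: t => [w|w] /=; [exact: germs_cst|exact: (Hpsi _).1].
have zE2 : germ_eq S zeta (fun x => comb cc x + \sum_t via f (Psi t) (G (inr t)) x).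
  move=> a Sa.
  have E1 := filter_forall (nbhs_filter a) (fun m => (Hh m).2 a Sa).
  have E2 := filter_forall (nbhs_filter a) (fun w => (Hr w).2 a Sa).
  have E3 := filter_forall (nbhs_filter a) (fun w => (Hpsi w).2 a Sa).
  apply: filterS2 (filterI (zE a Sa) E1) (filterI E2 E3) => x [-> {}E1] [{}E2 {}E3].
  have -> : comb cc x = \sum_m \sum_t (c m t * e t x) *: partial m x.
    rewrite /comb exchange_big /= pair_bigA /=; apply: eq_bigr => u _.
    by rewrite mxE enum_rankK.
  have -> : \sum_t via f (Psi t) (G (inr t)) x =
     \sum_m \sum_s q s x *: (h m s x *: partial m x).
    rewrite big_sumType /= /via /=.
    have -> : \sum_(w : T2 * T1 * 'I_n)
        d (w.2, w.1.1) w.1.2 *: ((q w.1.1 x * e w.1.2 x) *: partial w.2 x) =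
      \sum_m \sum_s \sum_t d (m, s) t *: ((q s x * e t x) *: partial m x).
      under [RHS]eq_bigr do rewrite pair_bigA /=.
      by rewrite exchange_big pair_bigA.
    have -> : \sum_(w : T2 * 'I_n) psi (w.2, w.1) (f x) *: (q w.1 x *: partial w.2 x) =
      \sum_m \sum_s psi (m, s) (f x) *: (q s x *: partial m x).
      by rewrite exchange_big pair_bigA.
    rewrite -big_split /=; apply: eq_bigr => m _; rewrite -big_split /=.
    apply: eq_bigr => s _; have /= -> := E2 (m, s); have /= -> := E3 (m, s).
    rewrite scalerDl scalerDr; congr (_ + _); last by rewrite !scalerA mulrC.
    rewrite scaler_suml scaler_sumr; apply: eq_bigr => t _.
    by rewrite !scalerA; congr (_ *: _); ring.
  rewrite -big_split /=; apply: eq_bigr => m _.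
  rewrite E1 scalerDl !scaler_suml; congr (_ + _).
  by apply: eq_bigr => s _; rewrite scalerA.
(* [comb cc] is [zeta] minus a combination of generators, both in TL_e(f); hence [cc] lies in the
   row space of [A]. *)
have Pcc : TLe S f (comb cc).
  pose zeta2 x := \sum_t via f (Psi t) (G (inr t)) x.
  have z2L : TLe S f zeta2.
    apply: (TLe_comb SPsi (fun t => GL (inr t))) => a Sa; near=> x.
    by [].
  apply: (@TLe_comb bool (fun t _ => if t then 1 else -1) (fun t => if t then zeta else zeta2)).
  + by case; exact: germs_cst.
  + by case.
  move=> a Sa; apply: filterS (zE2 a Sa) => x zx.
  by rewrite big_bool /via /= scale1r scaleN1r zx /zeta2 addrK.
have [u uE] := Agen _ Pcc.
exists (fun t => match t with inl i => fun=> u 0 i | inr t => Psi t end).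
  by case=> [i|t] //; exact: germs_cst.
move=> a Sa; apply: filterS (zE2 a Sa) => x ->.
rewrite [RHS]big_sumType /=; congr (_ + _).
rewrite /via /comb /=; under [RHS]eq_bigr do rewrite scaler_sumr.
rewrite exchange_big /=; apply: eq_bigr => w _.
rewrite uE mxE mulr_suml scaler_suml; apply: eq_bigr => i _.
by rewrite mxE scalerA mulrA.
Unshelve. all: by end_near. Qed.
End Determined.
End Main.

Theorem theorem1 (R : realType) (b : scalars) (n p r : nat)
  (S : set 'rV[scalar_field R b]_n)
  (f : 'rV[scalar_field R b]_n -> 'rV[scalar_field R b]_p) :
  (S #= `I_r)%card ->
  multigerm S f ->
  finitely_L_determined S f ->
  finitely_generated_via S f (TRe S f `&` TLe S f).
Proof.
move=> Sr mf [l _ det].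
have finS : finite_set S by exists r.
(* For [p = 0] there is no component from which [vanishing_pullback] could read off [psi]; but then
   all fields along [f] are zero and the empty family generates. *)
case: p f mf det => [|p] f mf det; last exact: (TRe_TLe_finitely_generated finS mf det ord0).
have eq0 (x y : 'rV[scalar_field R b]_0) : x = y by rewrite [x]thinmx0 [y]thinmx0.
have zero_germ m k (U : set 'rV[scalar_field R b]_m) :
    smooth_germ b U (fun=> 0 : 'rV[scalar_field R b]_k).
  by apply/smooth_germ_rowP => j; exact: germs_cst.
exists 0%N, (fun i _ => 0); apply/seteqP; split => zeta _.
  exists (fun i _ => 0) => [[]//|a Sa]; near=> x; exact: eq0.
split.
  exists (fun=> 0); first exact: zero_germ.
  by move=> a Sa; near=> x; exact: eq0.
exists (fun=> 0); first exact: zero_germ.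
by move=> a Sa; near=> x; exact: eq0.
Unshelve. all: by end_near. Qed.
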